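(* Let $N_1,N_2,\Sigma_1,\Sigma_2,\Omega_1,\Omega_2$ and $\kappa<1$ be as described in the context. Let $f\in L^1(\Omega_1)$ with $f>0$ a.e., and let $\mu$ be a Radon measure in $\Omega_2$ such that $\int_{\Omega_1}f(x)\,dx=\mu(\Omega_2)$. Then for each $x_0\in\Omega_1$ and $R_0>0$, there exists a weak solution $\mathcal{S}=\{\rho(x)x:x\in\Omega_1\}$ to the refractor problem with data $f,\mu$ passing through the point $X_0=R_0x_0$ (that is, $\rho(x_0)=R_0$).
   Context: Setting. $N_1,N_2$ are norms in $\mathbb{R}^n$ ($n\ge 2$), $\Sigma_i=\{x\in\mathbb{R}^n:N_i(x)=1\}$, $i=1,2$. Both $\Sigma_1$ and $\Sigma_2$ are $C^1$ (equivalently $N_i\in C^1(\mathbb{R}^n\setminus\{0\})$) and strictly convex (contain no nondegenerate segment). Put $p_i=\nabla N_i$. It is assumed that $$\kappa:=\sup_{N_1(x)=1}N_2(x)<1 .$$ $\Omega_1\subset\Sigma_1$ and $\Omega_2\subset\Sigma_2$ are closed domains (closures of nonempty connected relatively open sets) such that: the surface measure of the boundary of $\Omega_1$ (relative to $\Sigma_1$) is zero; and $\inf_{x\in\Omega_1,\,m\in\Omega_2}m\cdot p_1(x)\ge 1$. Here $\cdot$ is the Euclidean inner product, and $dx$ denotes surface measure on $\Sigma_1$. (Under these assumptions $1-x\cdot p_2(m)\ge 1-\kappa>0$ for $x\in\Sigma_1$, $m\in\Sigma_2$.) Refractor. A surface $S=\{\rho(x)x:x\in\Omega_1\}$ with $\rho\in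 C(\Omega_1)$, $\rho>0$, is a refractor from $\Omega_1$ to $\Omega_2$ if for each $x_0\in\Omega_1$ there exist $m\in\Omega_2$ and $b>0$ such that $$\rho(x)\le\frac{b}{1-x\cdot p_2(m)}\quad\text{for all }x\in\Omega_1,\text{ with equality at }x=x_0. \qquad ( * )$$ The refractor mapping of $S$ is the set-valued map $$\mathcal{R}_S(x_0)=\{m\in\Omega_2:\ ( * )\text{ holds for some }b>0\},\qquad x_0\in\Omega_1 .$$ Refractor measure. For $f\in L^1(\Omega_1)$, $f\ge0$, and Borel $E\subset\Omega_2$, $$\mathcal{M}_{S,f}(E)=\int_{\mathcal{R}_S^{-1}(E)}f(x)\,dx,\qquad \mathcal{R}_S^{-1}(E)=\{x\in\Omega_1:\mathcal{R}_S(x)\cap E\ne\emptyset\};$$ this is a Borel measure on $\Omega_2$. Weak solution. Let $\mu$ be a Radon measure in $\Omega_2$ with $\int_{\Omega_1}f\,dx=\mu(\Omega_2)$. A refractor $S$ from $\Omega_1$ to $\Omega_2$ is a weak solution of the refractor problem (with data $f,\mu$) if $\mathcal{M}_{S,f}(E)=\mu(E)$ for each Borel set $E\subset\Omega_2$. *)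

(* Defs.v *)
From HB Require Import structures.
From mathcomp Require Import all_boot all_order all_algebra.
From mathcomp Require Import all_classical all_reals all_analysis.

Set Implicit Arguments.
Unset Strict Implicit.
Unset Printing Implicit Defensive.

Import Order.TTheory GRing.Theory Num.Theory.
Import numFieldNormedType.Exports.

Local Open Scope classical_set_scope.
Local Open Scope ring_scope.

(* The library norm on 'rV[R]_n is the sup norm, so the Euclidean structure is
   introduced separately; the topologies coincide. *)
Definition dotp (R : realType) (n : nat) (u v : 'rV[R]_n) : R :=
  \sum_(j < n) u 0 j * v 0 j.

Definition enorm (R : realType) (n : nat) (u : 'rV[R]_n) : R :=
  Num.sqrt (dotp u u).

Record is_norm (R : realType) (n : nat) (N : 'rV[R]_n -> R) : Prop := IsNorm {
  is_norm_eq0 : forall x, N x = 0 -> x = 0 ;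
  is_normZ : forall (a : R) x, N (a *: x) = `|a| * N x ;
  is_normD : forall x y, N (x + y) <= N x + N y }.

Definition unit_sphere (R : realType) (n : nat) (N : 'rV[R]_n -> R) :
  set 'rV[R]_n := [set x | N x = 1].

Definition gradient (R : realType) (n : nat) (N : 'rV[R]_n -> R)
  (x : 'rV[R]_n) : 'rV[R]_n := \row_j 'D_(delta_mx 0 j) N x.

Definition C1_away_from_0 (R : realType) (n : nat) (N : 'rV[R]_n -> R) : Prop :=
  forall x, x != 0 ->
    differentiable N x /\ {for x, continuous (gradient N)}.

Definition contains_no_segment (R : realType) (n : nat) (S : set 'rV[R]_n) :
  Prop := forall x y, x != y ->
    ~ (forall t : R, 0 <= t <= 1 -> S ((1 - t) *: x + t *: y)).

(* closure, relative to S, of a nonempty connected relatively open subset of S *)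
Definition closed_domain (R : realType) (n : nat) (S Om : set 'rV[R]_n) : Prop :=
  exists U : set 'rV[R]_n,
    [/\ U !=set0, connected U,
        exists2 V : set 'rV[R]_n, open V & U = V `&` S
      & Om = closure U `&` S].

Definition rel_boundary (R : realType) (n : nat) (S A : set 'rV[R]_n) :
  set 'rV[R]_n := S `&` closure A `&` closure (S `\` A).

(* volume of the unit ball of R^d, by the recursion
   omega_(d+2) = 2 pi / (d + 2) * omega_d *)
Fixpoint unit_ball_volume (R : realType) (d : nat) : R :=
  match d with
  | 0%N => 1
  | 1%N => 2
  | (d'.+1 as d1).+1 => 2 * pi / d1.+1%:R * unit_ball_volume R d'
  end.

Lemma unit_ball_volume_gt0 (R : realType) (d : nat) :
  0 < unit_ball_volume R d.
Proof.
suff : 0 < unit_ball_volume R d /\ 0 < unit_ball_volume R d.+1 by case.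
elim: d => [|d [IH1 IH2]]; first by split => //=.
split=> //=; rewrite mulr_gt0// divr_gt0 ?mulr_gt0 ?pi_gt0 ?ltr0n//.
Qed.

Definition ediam (R : realType) (n : nat) (C : set 'rV[R]_n) : \bar R :=
  ereal_sup [set (enorm (x - y))%:E | x in C & y in C].

Lemma ediam_ge0 (R : realType) (n : nat) (C : set 'rV[R]_n) :
  C !=set0 -> (0 <= ediam C)%E.
Proof.
move=> [x Cx]; apply: le_trans (ereal_sup_ubound _); last first.
  by exists x => //; exists x.
by rewrite lee_fin sqrtr_ge0.
Qed.

(* omega_d * (diam C / 2) ^ d, the normalization for which H^d is the usual
   d-dimensional area; the empty set, for which ediam is -oo, weighs 0 *)
Definition hausdorff_weight (R : realType) (n d : nat) (C : set 'rV[R]_n) :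
    \bar R :=
  if `[< C = set0 >] then 0%E
  else ((unit_ball_volume R d / 2 ^+ d)%:E * ediam C ^+ d)%E.

Definition hausdorff_pre (R : realType) (n d : nat) (delta : R)
    (A : set 'rV[R]_n) : \bar R :=
  ereal_inf [set (\sum_(k <oo) hausdorff_weight d (C k))%E |
    C in [set C : (set 'rV[R]_n)^nat |
      (forall k, (ediam (C k) <= delta%:E)%E) /\ A `<=` \bigcup_k C k]].

Definition hausdorff_outer (R : realType) (n d : nat) (A : set 'rV[R]_n) :
    \bar R :=
  ereal_sup [set hausdorff_pre d delta A | delta in [set delta : R | 0 < delta]].

Section hausdorff_outer_theory.
Variables (R : realType) (n d : nat).
Implicit Types (A B C : set 'rV[R]_n) (delta : R).
Local Open Scope ereal_scope.

Lemma hausdorff_weight0 : hausdorff_weight d (set0 : set 'rV[R]_n) = 0.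
Proof. by rewrite /hausdorff_weight; case: asboolP. Qed.

Lemma hausdorff_weight_ge0 C : 0 <= hausdorff_weight d C.
Proof.
rewrite /hausdorff_weight; case: asboolP => // /eqP/set0P C0.
rewrite mule_ge0// ?expe_ge0 ?ediam_ge0// lee_fin divr_ge0 ?exprn_ge0//.
exact/ltW/unit_ball_volume_gt0.
Qed.

Lemma ediam0 : ediam (set0 : set 'rV[R]_n) = -oo.
Proof.
rewrite /ediam (_ : [set _ | _ in _ & _ in _] = set0) ?ereal_sup0//.
by apply/seteqP; split => // z [].
Qed.

Lemma hausdorff_pre_ge0 delta A : 0 <= hausdorff_pre d delta A.
Proof.
apply: le_ereal_inf_tmp => _ [C _ <-].
by apply: nneseries_ge0 => k _ _; exact: hausdorff_weight_ge0.
Qed.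

Lemma le_hausdorff_pre delta A B : A `<=` B ->
  hausdorff_pre d delta A <= hausdorff_pre d delta B.
Proof.
move=> AB; apply: ereal_inf_le_tmp => _ [C [dC BC] <-]; exists C => //.
by split=> //; exact: subset_trans BC.
Qed.

Lemma hausdorff_pre0 delta : hausdorff_pre d delta (set0 : set 'rV[R]_n) = 0.
Proof.
apply/eqP; rewrite eq_le hausdorff_pre_ge0 andbT.
apply: ereal_inf_lbound; exists (fun=> set0).
  by split => // k; rewrite ediam0 leNye.
by apply: eseries0 => k _ _; exact: hausdorff_weight0.
Qed.

Lemma hausdorff_pre_sigma_subadditive delta :
  sigma_subadditive (@hausdorff_pre R n d delta).
Proof.
move=> A; have [[i ioo]|] := pselect (exists i, hausdorff_pre d delta (A i) = +oo).
  rewrite (eseries_pinfty _ _ ioo) ?leey// => k _.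
  by rewrite -ltNye (lt_le_trans _ (hausdorff_pre_ge0 _ _)).
rewrite -forallNE => Aoo.
suff add2e (e : {posnum R}) : hausdorff_pre d delta (\bigcup_k A k) <=
    \sum_(i <oo) hausdorff_pre d delta (A i) + e%:num%:E.
  by apply/lee_addgt0Pr => _/posnumP[].
rewrite (le_trans _ (epsilon_trick _ _ _))//; last first.
  by move=> k; exact: hausdorff_pre_ge0.
pose P k (B : (set 'rV[R]_n)^nat) :=
  ((forall i, ediam (B i) <= delta%:E) /\ A k `<=` \bigcup_i B i) /\
  \sum_(i <oo) hausdorff_weight d (B i) <=
    hausdorff_pre d delta (A k) + (e%:num / (2 ^ k.+1)%:R)%:E.
have [G PG] : {G : ((set 'rV[R]_n)^nat)^nat & forall k, P k (G k)}.
  apply: (@choice _ _ P) => k; rewrite /P.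
  have Ak_fin : hausdorff_pre d delta (A k) \is a fin_num.
    by rewrite ge0_fin_numE ?hausdorff_pre_ge0// ltey; apply/eqP/Aoo.
  have en1 : (0 < e%:num / (2 ^ k.+1)%:R)%R by [].
  have [_ [B BA <-] Blt] := lb_ereal_inf_adherent en1 Ak_fin.
  by exists B; split => //; exact: ltW.
have w_ge0 x : 0 <= (@hausdorff_weight R n d \o uncurry G) x.
  exact: hausdorff_weight_ge0.
apply: (@le_trans _ _
    (\esum_(i in setT) (@hausdorff_weight R n d \o uncurry G) i)).
  apply: ereal_inf_lbound => /=.
  have /card_esym/ppcard_eqP[f] := card_nat2.
  exists (uncurry G \o f).
    split => [i|].
      by rewrite /= /uncurry; case: (f i) => a b; exact: (PG a).1.1.
    move=> t [k _] /(PG k).1.2[j _ Gt].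
    by exists (f^-1%FUN (k, j)) => //=; rewrite invK ?inE.
  rewrite -(esum_pred_image (@hausdorff_weight R n d \o uncurry G) _ xpredT)
    ?[fun=> _]set_true//.
  by rewrite image_eq.
rewrite (_ : esum _ _ =
    \sum_(i <oo) \sum_(j <oo) hausdorff_weight d (G i j)); last first.
  pose J : nat -> set (nat * nat) := fun i => [set (i, j) | j in setT].
  rewrite (_ : setT = \bigcup_k J k); last first.
    by rewrite predeqE => -[a b]; split => // _; exists a => //; exists b.
  rewrite esum_bigcupT /=; last 2 first.
    - apply/trivIsetP => i j _ _ ij.
      rewrite predeqE => -[k m] /=; split => //= -[] [_] _ [<-{k} _].
      by move=> [m' _] [] /esym/eqP; rewrite (negbTE ij).
    - by move=> x; exact: w_ge0.
  rewrite -(image_id [set: nat]) -fun_true esum_pred_image//; last first.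
    by move=> k _; apply: esum_ge0 => ij _; exact: w_ge0.
  apply: eq_eseriesr => /= j _.
  rewrite -(esum_pred_image (@hausdorff_weight R n d \o uncurry G)
    (pair j) predT)//=; last by move=> ? ? _ _; exact: (@can_inj _ _ _ snd).
    by congr esum; rewrite predeqE => -[a b]; split; move=> [i _ <-]; exists i.
  by move=> k _; exact: hausdorff_weight_ge0.
apply: lee_nneseries => [k _|k _]; last exact: (PG k).2.
by move=> _; apply: nneseries_ge0 => m _ _; exact: (w_ge0 (k, m)).
Qed.

Lemma hausdorff_outer0 : hausdorff_outer d (set0 : set 'rV[R]_n) = 0.
Proof.
apply/eqP; rewrite eq_le; apply/andP; split.
  by apply: ge_ereal_sup => _ [delta _ <-]; rewrite hausdorff_pre0.
by apply: ereal_sup_ubound; exists 1%R => /=; [exact: ltr01|exact: hausdorff_pre0].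
Qed.

Lemma hausdorff_outer_ge0 A : 0 <= hausdorff_outer d A.
Proof.
apply: le_trans (hausdorff_pre_ge0 1 A) _.
by apply: ereal_sup_ubound; exists 1%R => //; exact: ltr01.
Qed.

Lemma le_hausdorff_outer :
  {homo @hausdorff_outer R n d : A B / A `<=` B >-> A <= B}.
Proof.
move=> A B AB; apply: ge_ereal_sup => _ [delta delta0 <-].
apply: le_trans (le_hausdorff_pre _ AB) _.
by apply: ereal_sup_ubound; exists delta.
Qed.

Lemma hausdorff_outer_sigma_subadditive :
  sigma_subadditive (@hausdorff_outer R n d).
Proof.
move=> A; apply: ge_ereal_sup => _ [delta delta0 <-].
apply: le_trans (hausdorff_pre_sigma_subadditive _ _) _.
apply: lee_nneseries => [k _ _|k _]; first exact: hausdorff_pre_ge0.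
by apply: ereal_sup_ubound; exists delta.
Qed.

HB.instance Definition _ := isOuterMeasure.Build R 'rV[R]_n
  (@hausdorff_outer R n d) hausdorff_outer0 hausdorff_outer_ge0
  le_hausdorff_outer hausdorff_outer_sigma_subadditive.

End hausdorff_outer_theory.

Definition hausdorff_outer_measure (R : realType) (n d : nat) :
  {outer_measure set 'rV[R]_n -> \bar R} := @hausdorff_outer R n d.

(* The sigma-algebra is that of the Caratheodory-measurable sets of H^d. It is
   complete, so that sets which are Borel up to an H^d-null set, such as the
   refractor preimages below, are measurable. *)
Notation hausdorff_type R n d :=
  (caratheodory_type (hausdorff_outer_measure R n d)).

Definition hausdorff_measure (R : realType) (n d : nat) :
    {measure set (hausdorff_type R n d) -> \bar R} :=
  hausdorff_outer_measure R n d.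

(* Surface measure on hypersurfaces of R^n: the (n-1)-dimensional Hausdorff
   measure. *)
Notation surface_type R n := (hausdorff_type R n n.-1).
Notation surface_measure R n := (hausdorff_measure R n n.-1).

Notation borel_rV R n := (g_sigma_algebraType (@open 'rV[R]_n)).

(* A Radon measure in Om (Om closed) is given by the values of nu on the Borel
   subsets of Om; nothing is required of nu outside Om. *)
Definition radon_in (R : realType) (n : nat) (Om : set 'rV[R]_n)
    (nu : {measure set (borel_rV R n) -> \bar R}) : Prop :=
  (forall K : set 'rV[R]_n, compact K -> K `<=` Om -> (nu K < +oo)%E) /\
  (forall E : set (borel_rV R n), measurable E -> E `<=` Om ->
    nu E = ereal_sup [set nu K |
      K in [set K : set 'rV[R]_n | compact K /\ K `<=` E]]).

(* The surface S = {rho(x) x : x in Om1} is represented by rho, of which only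
   the values on Om1 matter. *)

Definition supported_at (R : realType) (n : nat) (N2 : 'rV[R]_n -> R)
    (Om1 : set 'rV[R]_n) (rho : 'rV[R]_n -> R) (x0 m : 'rV[R]_n) (b : R) :
    Prop :=
  (forall x, Om1 x -> rho x <= b / (1 - dotp x (gradient N2 m))) /\
  rho x0 = b / (1 - dotp x0 (gradient N2 m)).

Definition refractor_map (R : realType) (n : nat) (N2 : 'rV[R]_n -> R)
    (Om1 Om2 : set 'rV[R]_n) (rho : 'rV[R]_n -> R) (x0 : 'rV[R]_n) :
    set 'rV[R]_n :=
  [set m | Om2 m /\ exists2 b : R, 0 < b & supported_at N2 Om1 rho x0 m b].

Definition is_refractor (R : realType) (n : nat) (N2 : 'rV[R]_n -> R)
    (Om1 Om2 : set 'rV[R]_n) (rho : 'rV[R]_n -> R) : Prop :=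
  [/\ {within Om1, continuous rho},
      forall x, Om1 x -> 0 < rho x
    & forall x0, Om1 x0 -> refractor_map N2 Om1 Om2 rho x0 !=set0].

Definition refractor_preimage (R : realType) (n : nat) (N2 : 'rV[R]_n -> R)
    (Om1 Om2 : set 'rV[R]_n) (rho : 'rV[R]_n -> R) (E : set 'rV[R]_n) :
    set 'rV[R]_n :=
  [set x | Om1 x /\ refractor_map N2 Om1 Om2 rho x `&` E !=set0].

Definition refractor_measure (R : realType) (n : nat) (N2 : 'rV[R]_n -> R)
    (Om1 Om2 : set 'rV[R]_n) (rho : 'rV[R]_n -> R)
    (f : surface_type R n -> R) (E : set 'rV[R]_n) : \bar R :=
  (\int[surface_measure R n]_(x in refractor_preimage N2 Om1 Om2 rho E)
     (f x)%:E)%E.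

Definition weak_solution (R : realType) (n : nat) (N2 : 'rV[R]_n -> R)
    (Om1 Om2 : set 'rV[R]_n) (f : surface_type R n -> R)
    (mu : {measure set (borel_rV R n) -> \bar R}) (rho : 'rV[R]_n -> R) :
    Prop :=
  is_refractor N2 Om1 Om2 rho /\
  forall E : set (borel_rV R n), measurable E -> E `<=` Om2 ->
    refractor_measure N2 Om1 Om2 rho f E = mu E.

(* Main.v *)
Require Import Defs.
From HB Require Import structures.
From mathcomp Require Import all_boot all_order all_algebra.
From mathcomp Require Import all_classical all_reals all_analysis.
From mathcomp Require Import numfun measurable_realfun ring lra.
Import Order.TTheory GRing.Theory Num.Theory.
Import numFieldNormedType.Exports.

(** Put k(x, m) = - ln (1 - x.p2(m)), u = ln rho and v = - ln b. A supporting
inequality of the refractor then reads u(x) + v(m) <= k(x, m), with equality at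
the point of contact, so that a refractor is one half of a pair of k-conjugate
functions, and prescribing its measure is the optimality condition of the dual
transport problem for the cost k between f dx on Om1 and mu on Om2.

Existence comes from this variational problem: maximize
int u f dx + int v dmu subject to u + v <= k. Since k is Lipschitz in x uniformly
in m, the competitors u may be taken equi-Lipschitz and bounded, so a cluster
point of a maximizing sequence for pointwise convergence is a maximizer, and it
may be replaced by a conjugate pair. Raise v by t on a closed set K: the
conjugate u goes down by at most t, and only at points where K comes within t of
contact. Optimality and t -> 0 give mu(K) <= (f dx)(R^-1(K)) for every closed K
(kantorovich_potentials). Only measurability of the perturbed v matters here, so
indicators can be used directly.

These one-sided bounds become equalities because almost every x has one contact
only (double_contact_null): inner regularity extends the bound to Borel sets E,
the bounds for E and for its complement in Om2 add up to the total mass, and the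
two preimages overlap in a null set (rel_preimage_measure).

For the null set, note that 1 / rho is the restriction to Om1 of the
convex, positively homogeneous function
w(x) = sup_m (N1(x) - x.p2(m)) / b(m), for which a contact m of x yields the
subgradient (p1(x) - p2(m)) / b(m). Two different contacts never yield the same
subgradient: otherwise p2(m') = p2(m) + t (p1(x) - p2(m)) with t >= 0, up to
exchanging m and m', hence m.p2(m') >= 1 by m.p1(x) >= 1, which strict convexity
of the sphere of N2 forbids. So x is a kink of w, and kinks are negligible on the
sphere (sphere_kinks_null). By homogeneity it is enough to look at the faces of a
cube; there, on a grid of mesh 1/N, each line meets a bounded number of cells
with a definite kink along that line, because the second differences of w are
nonnegative and telescope. About N^(n-2) cells of diameter 1/N remain, and their
(n-1)-dimensional weight tends to 0.

Borel sets are measurable for the Hausdorff measure by Caratheodory's criterion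
for metric outer measures (borel_caratheodory). *)

Set Implicit Arguments.
Unset Strict Implicit.
Unset Printing Implicit Defensive.
Local Open Scope classical_set_scope.
Local Open Scope ring_scope.

(** * Row vectors: sup norm, Euclidean norm and inner product *)

Section rowvec.
Variables (R : realType) (n : nat).
Implicit Types (x y z : 'rV[R]_n).

Lemma coord_le_norm x j : `|x 0 j| <= `|x|.
Proof.
by rewrite [leRHS]mx_normrE; apply: (@le_bigmax _ _ _ _ (fun i => `|x i.1 i.2|) (0, j)).
Qed.

Lemma norm_le_coord x c : 0 <= c -> (forall j, `|x 0 j| <= c) -> `|x| <= c.
Proof.
move=> c0 xc; rewrite [leLHS]mx_normrE; apply/bigmax_leP; split => // -[i j] _ /=.
by rewrite ord1.
Qed.

Lemma norm_attained x : x != 0 -> exists j, `|x| = `|x 0 j|.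
Proof.
move=> x0; have : mx_norm x != 0 by apply: contra_neq x0 => /mx_norm_eq0.
by move=> /mx_norm_neq0[[i j] /=]; rewrite ord1 => ?; exists j.
Qed.

Lemma dotpC x y : dotp x y = dotp y x.
Proof. by apply: eq_bigr => j _; rewrite mulrC. Qed.

Lemma dotpDl x y z : dotp (x + y) z = dotp x z + dotp y z.
Proof. by rewrite -big_split; apply: eq_bigr => j _; rewrite mxE mulrDl. Qed.

Lemma dotpZl a x z : dotp (a *: x) z = a * dotp x z.
Proof. by rewrite mulr_sumr; apply: eq_bigr => j _; rewrite mxE mulrA. Qed.

Lemma dotpNl x z : dotp (- x) z = - dotp x z.
Proof. by rewrite -scaleN1r dotpZl mulN1r. Qed.

Lemma dotpBl x y z : dotp (x - y) z = dotp x z - dotp y z.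
Proof. by rewrite dotpDl dotpNl. Qed.

Lemma dotpDr z x y : dotp z (x + y) = dotp z x + dotp z y.
Proof. by rewrite dotpC dotpDl !(dotpC z). Qed.

Lemma dotpZr a x z : dotp z (a *: x) = a * dotp z x.
Proof. by rewrite dotpC dotpZl dotpC. Qed.

Lemma dotpBr z x y : dotp z (x - y) = dotp z x - dotp z y.
Proof. by rewrite dotpC dotpBl !(dotpC z). Qed.

Lemma dotp_delta x j : dotp x (delta_mx 0 j) = x 0 j.
Proof.
rewrite /dotp (bigD1 j)//= mxE !eqxx mulr1 big1 ?addr0// => i ij.
by rewrite mxE eqxx (negbTE ij) mulr0.
Qed.

Lemma dotp_le_norm x y : `|dotp x y| <= n%:R * `|x| * `|y|.
Proof.
apply: le_trans (ler_norm_sum _ _ _) _.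
apply: (@le_trans _ _ (\sum_(j < n) `|x| * `|y|)).
  by apply: ler_sum => j _; rewrite normrM ler_pM// coord_le_norm.
by rewrite sumr_const card_ord -mulrA mulr_natl.
Qed.

Lemma norm_le_enorm x : `|x| <= enorm x.
Proof.
apply: norm_le_coord => [|j]; first exact: sqrtr_ge0.
rewrite -sqrtr_sqr ler_sqrt ?sumr_ge0// => [|i _]; last by rewrite -expr2 sqr_ge0.
rewrite /dotp (bigD1 j)//= -expr2 lerDl sumr_ge0// => i _.
by rewrite -expr2 sqr_ge0.
Qed.

Lemma enorm_le_norm x : enorm x <= n%:R * `|x|.
Proof.
have nx : 0 <= n%:R * `|x| by rewrite mulr_ge0.
rewrite -[leRHS]ger0_norm// -sqrtr_sqr ler_sqrt ?sqr_ge0//.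
apply: le_trans (ler_norm _) _; apply: le_trans (dotp_le_norm _ _) _.
rewrite -mulrA -expr2 exprMn ler_wpM2r ?sqr_ge0// -natrX ler_nat.
by rewrite -{1}(expn1 n); case: (n) => // k; rewrite leq_pexp2l.
Qed.

End rowvec.

(** * Caratheodory's criterion for Hausdorff outer measures *)

Section metric_outer_measure.
Variables (R : realType) (n d : nat).
Local Notation V := 'rV[R]_n.
Local Notation H := (@hausdorff_outer R n d).
Local Open Scope ereal_scope.

Lemma hausdorff_pre_anti (delta delta' : R) (A : set V) : (delta <= delta')%R ->
  hausdorff_pre d delta' A <= hausdorff_pre d delta A.
Proof.
move=> dd; apply: ereal_inf_le_tmp => _ [C [dC AC] <-]; exists C => //; split => //.
by move=> k; rewrite (le_trans (dC k))// lee_fin.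
Qed.

Lemma norm_le_ediam (C : set V) x y : C x -> C y -> (`|x - y|)%:E <= ediam C.
Proof.
move=> Cx Cy; apply: (@le_trans _ _ (enorm (x - y))%:E).
  by rewrite lee_fin norm_le_enorm.
by apply: ereal_sup_ubound; exists x => //; exists y.
Qed.

(** A covering set of diameter less than the gap e cannot meet both A and B, so
a cover of the union splits into a cover of each. *)
Lemma hausdorff_preU_separated (delta e : R) (A B : set V) : (delta < e)%R ->
    (forall x y, A x -> B y -> (e <= `|x - y|)%R) ->
  hausdorff_pre d delta A + hausdorff_pre d delta B <=
  hausdorff_pre d delta (A `|` B).
Proof.
move=> de AB; apply: le_ereal_inf_tmp => _ [C [dC ABC] <-].
pose restr (D : set V) k := if `[< C k `&` D !=set0 >] then C k else set0.
have restr_cover (D : set V) : D `<=` A `|` B ->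
    hausdorff_pre d delta D <= \sum_(k <oo) hausdorff_weight d (restr D k).
  move=> DAB; apply: ereal_inf_lbound; exists (restr D) => //; split.
    by move=> k; rewrite /restr; case: asboolP => // _; rewrite ediam0 leNye.
  move=> x Dx; have [k _ Ckx] := ABC _ (DAB _ Dx); exists k => //.
  by rewrite /restr; case: asboolP => // -[]; exists x.
apply: le_trans (leeD (restr_cover A _) (restr_cover B _)) _.
- by move=> ?; left.
- by move=> ?; right.
rewrite -nneseriesD; try by move=> *; exact: hausdorff_weight_ge0.
apply: lee_nneseries => k _; first by move=> _; rewrite adde_ge0// hausdorff_weight_ge0.
rewrite /restr; case: asboolP => [[x [Cx Ax]]|_]; last first.
  by rewrite hausdorff_weight0 add0e; case: asboolP; rewrite ?hausdorff_weight0 ?hausdorff_weight_ge0.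
case: asboolP => [[y [Cy By]]|_]; last by rewrite hausdorff_weight0 adde0.
have := le_trans (norm_le_ediam Cx Cy) (dC k); rewrite lee_fin => /(le_trans (AB _ _ Ax By)).
by rewrite leNgt de.
Qed.

(** The metric property of an outer measure, on which Caratheodory's criterion
rests. *)
Lemma hausdorff_outerU_separated (e : R) (A B : set V) : (0 < e)%R ->
    (forall x y, A x -> B y -> (e <= `|x - y|)%R) ->
  H A + H B <= H (A `|` B).
Proof.
move=> e0 AB.
have pre_le (d1 d2 : R) : (0 < d1)%R -> (0 < d2)%R ->
    hausdorff_pre d d1 A + hausdorff_pre d d2 B <= H (A `|` B).
  move=> d10 d20; pose d0 := Num.min (Num.min d1 d2) (e / 2)%R.
  have d00 : (0 < d0)%R by rewrite !lt_min d10 d20 divr_gt0.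
  have d0e : (d0 < e)%R by rewrite !gt_min (_ : e / 2 < e)%R ?orbT//; lra.
  apply: le_trans (leeD (hausdorff_pre_anti _ (_ : d0 <= d1)%R)
    (hausdorff_pre_anti _ (_ : d0 <= d2)%R)) _.
  - by rewrite !ge_min lexx.
  - by rewrite !ge_min lexx orbT.
  apply: le_trans (hausdorff_preU_separated d0e AB) _.
  by apply: ereal_sup_ubound; exists d0.
have [->|HU] := eqVneq (H (A `|` B)) +oo; first by rewrite leey.
have finU : H (A `|` B) \is a fin_num.
  by rewrite ge0_fin_numE ?ltey//; exact: hausdorff_outer_ge0.
have finA : H A \is a fin_num.
  rewrite ge0_fin_numE; last exact: hausdorff_outer_ge0.
  apply: (@le_lt_trans _ _ (H (A `|` B))); last by rewrite ltey.
  by apply: le_hausdorff_outer => ?; left.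
rewrite addeC -leeBrDr//; apply: ge_ereal_sup => _ [d2 d20 <-].
have finB : hausdorff_pre d d2 B \is a fin_num.
  rewrite ge0_fin_numE; last exact: hausdorff_pre_ge0.
  apply: (@le_lt_trans _ _ (H (A `|` B))); last by rewrite ltey.
  apply: (@le_trans _ _ (H B)); last by apply: le_hausdorff_outer => ?; right.
  by apply: ereal_sup_ubound; exists d2.
rewrite leeBrDr// addeC -leeBrDr//; apply: ge_ereal_sup => _ [d1 d10 <-].
by rewrite leeBrDr//; exact: pre_le.
Qed.

End metric_outer_measure.

Section caratheodory_criterion.
Variables (R : realType) (n d : nat).
Local Notation V := 'rV[R]_n.
Local Notation H := (@hausdorff_outer R n d).
Local Open Scope ereal_scope.
Variable g : V -> R.
Hypothesis g_lip : forall x y, (`|g x - g y| <= `|x - y|)%R.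

Let P (X : set V) k := X `&` [set x | (k.+1%:R^-1 <= g x)%R].
Let B (X : set V) k := X `&` [set x | (k.+2%:R^-1 <= g x < k.+1%:R^-1)%R].

Let gap_gt0 k : (0 < k.+1%:R^-1 - k.+2%:R^-1 :> R)%R.
Proof. by rewrite subr_gt0 ltf_pV2 ?posrE// ltr_nat. Qed.

Let sep (k : nat) x y :
  (k.+1%:R^-1 <= g x)%R -> (g y < k.+2%:R^-1)%R ->
  (k.+1%:R^-1 - k.+2%:R^-1 <= `|x - y|)%R.
Proof.
move=> gx gy; apply: le_trans (le_trans (ler_norm _) (g_lip x y)).
by rewrite lerB// ltW.
Qed.

(** Rings of the same parity are at positive distance from each other, so their
measures add up; this is why even and odd rings are summed separately. *)
Let rings_le X o m : \sum_(j < m.+1) H (B X (j.*2 + o)) <= H (P X (m.*2 + o).+1).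
Proof.
elim: m => [|m IH].
  rewrite big_ord_recl big_ord0 adde0 /= add0n.
  by apply: le_hausdorff_outer => x [Xx /andP[]].
rewrite big_ord_recr /=; apply: le_trans (leeD2r _ IH) _.
apply: le_trans (@hausdorff_outerU_separated _ _ _ _ _ _ (gap_gt0 (m.*2 + o).+1) _) _.
  move=> x y [_ /= gx] [_ /andP[_]]; rewrite doubleS !addSn => gy.
  exact: sep gx gy.
apply: le_hausdorff_outer => x [[Xx /= gx]|[Xx /andP[gx _]]]; split => //=.
apply: le_trans gx; rewrite lef_pV2 ?posrE// ler_nat doubleS !addSn !ltnS.
by apply: leqW; apply: leqW.
Qed.

(** The series converges, so its tails, which bound what is lost by removing the
levels of g below 1 / (k + 1), are small. *)
Let rings_sum_le X : \sum_(k <oo) H (B X k) <= H X + H X.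
Proof.
apply: lime_le.
  by apply: is_cvg_nneseries => k _ _; exact: hausdorff_outer_ge0.
near=> m.
have half_le o : \sum_(j < m) H (B X (j.*2 + o)) <= H X.
  case: (m) => [|m']; first by rewrite big_ord0 hausdorff_outer_ge0.
  apply: le_trans (rings_le _ _ _) _.
  by apply: le_hausdorff_outer => x [].
apply: (@le_trans _ _ (\sum_(j < m) H (B X (j.*2 + 0)) +
                       \sum_(j < m) H (B X (j.*2 + 1)))); last exact: leeD.
apply: (@le_trans _ _ (\sum_(0 <= j < m.*2) H (B X j))).
  have mm : (m <= m.*2)%N by rewrite -addnn leq_addr.
  rewrite (big_cat_nat (leq0n m) mm)/=.
  by rewrite leeDl// sume_ge0// => i _; exact: hausdorff_outer_ge0.
elim: (m) => [|m' IH]; first by rewrite !big_ord0 big_geq// adde0.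
rewrite doubleS !big_nat_recr//= !big_ord_recr/= addn0 addn1.
by rewrite [leRHS]addeACA -[leLHS]addeA; apply: leeD2r.
Unshelve. all: by end_near. Qed.

Let outer_limit X k :
  H (X `&` [set x | (0 < g x)%R]) <= H (P X k) + \sum_(k <= j <oo) H (B X j).
Proof.
apply: le_trans (leeD2l _ (outer_measure_sigma_subadditive_tail
   (hausdorff_outer_measure R n d) k (B X))).
apply: le_trans (outer_measureU2 (hausdorff_outer_measure R n d) _ _).
apply: le_hausdorff_outer => x [Xx /= gx].
have [gxk|gxk] := leP (k.+1%:R^-1)%R (g x); first by left.
have exj : exists j, (j.+2%:R^-1 <= g x)%R.
  have gx0 : (0 <= (g x)^-1)%R by rewrite invr_ge0 ltW.
  exists (Num.truncn (g x)^-1); rewrite -[leRHS]invrK lef_pV2 ?posrE ?invr_gt0//.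
  have /andP[_ /ltW h] := truncn_itv gx0.
  by apply: le_trans h _; rewrite ler_nat.
case: (ex_minnP exj) => j gj jmin; right; exists j.
  move=> /= jk; have := le_lt_trans gj gxk; rewrite ltf_pV2 ?posrE// ltr_nat.
  by rewrite !ltnS leqNgt jk.
split => //=; rewrite gj /=; case: j jmin {gj} => [_|j jmin].
  by apply: lt_le_trans gxk _; rewrite lef_pV2 ?posrE// ler_nat.
by rewrite ltNge; apply/negP => /jmin; rewrite ltnn.
Qed.

(** Away from the zero level of g the set is at positive distance from its
complement; the layer in between is a tail of the convergent series of rings. *)
Lemma caratheodory_pos_set : (hausdorff_outer_measure R n d).-caratheodory
  [set x | (0 < g x)%R].
Proof.
apply: le_caratheodory_measurable => X /=.
rewrite /hausdorff_outer_measure.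
have [->|HX] := eqVneq (H X) +oo; first by rewrite leey.
have finX : H X \is a fin_num.
  by rewrite ge0_fin_numE ?ltey//; exact: hausdorff_outer_ge0.
have tail0 : \sum_(k <= j <oo) H (B X j) @[k --> \oo] --> 0.
  apply: (@nneseries_tail_cvg R (fun j => H (B X j)) xpredT).
    by apply: le_lt_trans (rings_sum_le X) _; rewrite lte_add_pinfty// ltey.
  by move=> k _; exact: hausdorff_outer_ge0.
apply/lee_addgt0Pr => e e0.
have [k tailk] : exists k, \sum_(k <= j <oo) H (B X j) < e%:E.
  have [|k _ /(_ k (leqnn k))] := tail0 [set x | x < e%:E].
    by apply: lt_nbhsl; exact: e0.
  by exists k.
apply: le_trans (leeD2r _ (outer_limit X k)) _.
rewrite addeAC; apply: leeD; last exact: ltW.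
have e1 : (0 < k.+1%:R^-1 :> R)%R by rewrite invr_gt0.
apply: le_trans (@hausdorff_outerU_separated _ _ _ _ _ _ e1 _) _.
  move=> x y [_ /= gx] [_ /= /negP]; rewrite -leNgt => gy.
  apply: le_trans (le_trans (ler_norm _) (g_lip x y)).
  by rewrite lerBrDr (le_trans _ gx)// gerDl.
by apply: le_hausdorff_outer => x [[]|[]].
Qed.

End caratheodory_criterion.

Section borel_caratheodory.
Variables (R : realType) (n d : nat).
Local Notation V := 'rV[R]_n.

Let dist (F : set V) (x : V) : R := inf [set `|x - z| | z in F].

Let dist_lip (F : set V) : F !=set0 ->
  forall x y, `|dist F x - dist F y| <= `|x - y|.
Proof.
move=> [z0 Fz0].
have lb x : has_lbound [set `|x - z| | z in F].
  by exists 0 => _ [z _ <-].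
have one x y : dist F x - dist F y <= `|x - y|.
  rewrite lerBlDr -lerBlDl; apply: lb_le_inf; first by exists `|y - z0|, z0.
  move=> _ [z Fz <-]; rewrite lerBlDl.
  apply: (@le_trans _ _ `|x - z|); first by apply: ge_inf => //; exists z.
  by rewrite (le_trans _ (ler_normD _ _))// addrA subrK.
by move=> x y; rewrite ler_norml one andbT lerNl opprB distrC one.
Qed.

(** An open set is the positivity set of the distance to its complement. *)
Lemma open_caratheodory (G : set V) : open G ->
  (hausdorff_outer_measure R n d).-caratheodory G.
Proof.
move=> oG; have [GT|/set0P F0] := eqVneq (~` G) set0.
  have -> : G = ~` set0 by rewrite -(setCK G) GT.
  exact/caratheodory_measurable_setC/caratheodory_measurable_set0.
suff -> : G = [set x | 0 < dist (~` G) x].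
  exact/caratheodory_pos_set/dist_lip.
have lb x : has_lbound [set `|x - z| | z in ~` G].
  by exists 0 => _ [z _ <-].
apply/seteqP; split => x /=; last first.
  move=> d0; apply: contrapT => nGx; move: d0; rewrite ltNge => /negP; apply.
  by apply: ge_inf => //; exists x => //; rewrite subrr normr0.
move=> Gx; have /nbhs_ballP[e /= e0 eG] : nbhs x G by exact: open_nbhs_nbhs.
apply: lt_le_trans e0 _; apply: lb_le_inf.
  by case: F0 => z Fz; exists `|x - z|, z.
move=> _ [z /= nGz <-]; rewrite leNgt; apply/negP => xz; apply: nGz.
by apply: eG; rewrite -ball_normE.
Qed.

Lemma borel_caratheodory (E : set (borel_rV R n)) : measurable E ->
  measurable (E : set (hausdorff_type R n d)).
Proof.
move=> mE; have := mE; apply; split; last by exact: open_caratheodory.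
split.
- exact: caratheodory_measurable_set0.
- by move=> A; rewrite setTD; exact: caratheodory_measurable_setC.
- exact: caratheodory_measurable_bigcup.
Qed.

End borel_caratheodory.

(** * Covers and Hausdorff-null sets *)

Section hausdorff_null.
Variables (R : realType) (n d : nat).
Local Notation V := 'rV[R]_n.
Local Notation H := (@hausdorff_outer R n d).

Lemma ediam_le (C : set V) (r : R) :
  (forall x y, C x -> C y -> `|x - y| <= r) -> (ediam C <= (n%:R * r)%:E)%E.
Proof.
move=> Cr; apply: ge_ereal_sup => _ [x Cx [y Cy <-]]; rewrite lee_fin.
by rewrite (le_trans (enorm_le_norm _))// ler_wpM2l// Cr.
Qed.

(** The constant that turns a d-th power of a diameter into a Hausdorff weight. *)
Definition hausdorff_const : R := unit_ball_volume R d / 2 ^+ d.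

Lemma hausdorff_const_ge0 : 0 <= hausdorff_const.
Proof. by rewrite divr_ge0 ?exprn_ge0//; exact/ltW/unit_ball_volume_gt0. Qed.

Lemma hausdorff_weight_le (C : set V) (r : R) : 0 <= r ->
  (forall x y, C x -> C y -> `|x - y| <= r) ->
  (hausdorff_weight d C <= (hausdorff_const * (n%:R * r) ^+ d)%:E)%E.
Proof.
move=> r0 Cr; rewrite /hausdorff_weight; case: asboolP => [_|/eqP/set0P C0].
  by rewrite lee_fin mulr_ge0 ?hausdorff_const_ge0// exprn_ge0// mulr_ge0.
rewrite -/hausdorff_const (EFinM hausdorff_const); apply: lee_wpmul2l; first by rewrite lee_fin hausdorff_const_ge0.
rewrite EFin_expe; elim: (d) => [|k IH]; first by rewrite !expe0.
by rewrite !expeS lee_pmul ?expe_ge0 ?ediam_ge0 ?ediam_le.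
Qed.

Lemma hausdorff_pre_finite_cover (T : finType) (C : T -> set V) (delta : R)
    (A : set V) : A `<=` \bigcup_t C t ->
    (forall t, (ediam (C t) <= delta%:E)%E) ->
  (hausdorff_pre d delta A <= \sum_t hausdorff_weight d (C t))%E.
Proof.
move=> AC Cdelta; pose D k := nth set0 [seq C t | t <- enum T] k.
apply: (@le_trans _ _ (\sum_(k <oo) hausdorff_weight d (D k))%E).
  apply: ereal_inf_lbound; exists D => //; split.
    move=> k; have [ks|ks] := ltnP k (size [seq C t | t <- enum T]).
      by rewrite /D; have /mapP[t _ ->] := mem_nth set0 ks.
    by rewrite /D nth_default// ediam0 leNye.
  move=> x /AC[t _ Ctx]; exists (index t (enum T)) => //.
  by rewrite /D (nth_map t) ?index_mem ?mem_enum// nth_index ?mem_enum.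
rewrite (nneseries_split _ (size [seq C t | t <- enum T])); last first.
  by move=> *; exact: hausdorff_weight_ge0.
rewrite add0n [X in (_ + X)%E]eseries0 ?adde0; last first.
  by move=> k sk _; rewrite /D nth_default// hausdorff_weight0.
by rewrite -(big_nth set0 xpredT (@hausdorff_weight R n d)) big_map big_enum.
Qed.

Lemma hausdorff_outer_eq0 (A : set V) :
  (forall delta e : R, 0 < delta -> 0 < e ->
    (hausdorff_pre d delta A <= e%:E)%E) -> H A = 0%E.
Proof.
move=> small; apply/eqP; rewrite eq_le hausdorff_outer_ge0 andbT.
apply: ge_ereal_sup => _ [delta delta0 <-].
by apply/lee_addgt0Pr => e e0; rewrite add0e; exact: small.
Qed.

Lemma hausdorff_outer_bigcup0 (T : countType) (A : T -> set V) :
  (forall t, H (A t) = 0%E) -> H (\bigcup_t A t) = 0%E.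
Proof.
move=> A0; pose B k := oapp A set0 (unpickle k).
apply/eqP; rewrite eq_le hausdorff_outer_ge0 andbT.
have AB : \bigcup_t A t `<=` \bigcup_k B k.
  by move=> x [t _ Atx]; exists (pickle t) => //; rewrite /B pickleK.
apply: (@le_trans _ _ (H (\bigcup_k B k))); first exact: le_hausdorff_outer.
apply: le_trans (@hausdorff_outer_sigma_subadditive R n d B) _.
rewrite eseries0// => k _ _; rewrite /B; case: (unpickle k) => [t|] /=.
  exact: A0.
exact: hausdorff_outer0.
Qed.

End hausdorff_null.

(** * Kinks of convex functions on a face of the cube *)

(** Shifting by M can be done in M unit shifts, each of which telescopes to the
two ends of the range; the bound is therefore independent of the length K. *)
Lemma sum_shift_diff_le (R : realType) (D : nat -> R) (c : R) (K M : nat) :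
  (forall s, `|D s| <= c) ->
  \sum_(0 <= r < K) (D (r + M)%N - D r) <= M%:R * (2 * c).
Proof.
move=> Dc; elim: M => [|M IH].
  by rewrite mul0r big1// => r _; rewrite addn0 subrr.
rewrite (eq_bigr (fun r => (D (r.+1 + M)%N - D (r + M)%N) +
                           (D (r + M)%N - D r))); last first.
  by move=> r _; rewrite addSnnS addrA subrK.
rewrite big_split/= (telescope_sumr (fun r => D (r + M)%N))//.
rewrite -natr1 mulrDl addrC lerD// mul1r mulr_natl mulr2n.
by apply: lerD; apply: le_trans (ler_norm _) _; rewrite ?normrN; exact: Dc.
Qed.

(** S consists of points of a face x_i = sigma of the cube at which w has a kink of
size at least eta in the direction e_j along the face. The conclusion concerns an
arbitrary Lipschitz image of S, because the radial projection of the face to a sphere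
is the image of interest. *)
Section kinks_on_hyperplane.
Variables (R : realType) (n : nat).
Local Notation V := 'rV[R]_n.
Variables (w : V -> R) (L : R) (i j : 'I_n) (sigma eta : R) (S : set V).
Variables (phi : V -> V) (C : R).
Hypothesis w_lip : forall x y, `|w x - w y| <= L * `|x - y|.
Hypothesis w_convex : forall x h, 2 * w x <= w (x + h) + w (x - h).
Hypothesis ij : j != i.
Hypothesis eta_gt0 : 0 < eta.
Hypothesis S_face : forall x, S x -> x 0 i = sigma.
Hypothesis S_box : forall x l, S x -> `|x 0 l| <= 1.
Local Notation e := (delta_mx 0 j : V).
Hypothesis S_kink : forall x t, S x -> 0 < t ->
  eta * t <= w (x + t *: e) + w (x - t *: e) - 2 * w x.
Hypothesis C_ge0 : 0 <= C.
Hypothesis phi_lip : forall x y, S x -> S y ->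
  `|phi x - phi y| <= C * `|x - y|.

Let second_diff x t := w (x + t *: e) + w (x - t *: e) - 2 * w x.

Let L_ge0 : 0 <= L.
Proof.
have := w_lip e 0; rewrite subr0 => h; have e0 : 0 < `|e|.
  rewrite normr_gt0; apply/eqP => /rowP/(_ j); rewrite !mxE !eqxx => /eqP.
  by rewrite oner_eq0.
by have := le_trans (normr_ge0 _) h; rewrite pmulr_lge0.
Qed.

Let norm_e : `|e| <= 1.
Proof.
apply: norm_le_coord => // l; rewrite mxE eqxx /=.
by case: (l == j); rewrite ?normr1 ?normr0.
Qed.

Let w_shift x t s : `|w (x + t *: e) - w (x + s *: e)| <= L * `|t - s|.
Proof.
apply: le_trans (w_lip _ _) _; rewrite ler_wpM2l//.
rewrite opprD addrACA subrr add0r -scalerBl normrZ.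
by rewrite ler_piMr.
Qed.

(** The coordinates other than i and j, which label the lines of the grid parallel
to e_j: the count of these lines carries the exponent n - 2. *)
Let D := {l : 'I_n | (l != i) && (l != j)}.

Let card_D : #|{: D}| = n.-2.
Proof.
rewrite card_sig -[n in RHS](card_ord n) -(cardC (pred2 i j)) card2 eq_sym ij /=.
by apply: eq_card => l; rewrite !inE negb_or.
Qed.

Section grid.
Variable N : nat.
Hypothesis N_gt0 : (0 < N)%N.
Let K := N.*2.+1.

(** The node with free coordinates a and j-th coordinate -1; the grid covers only
the face x_i = sigma. *)
Let base (a : {ffun D -> 'I_K}) : V :=
  \row_l oapp (fun t => -1 + (a t)%:R / N%:R) (if l == j then -1 else sigma)
    (insub l).
Let node a (r : nat) : V := base a + (r%:R / N%:R) *: e.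
Let cell a r : set V := [set x | S x /\ `|x - node a r| <= N%:R^-1].

Let N0 : 0 < N%:R :> R. Proof. by rewrite ltr0n. Qed.

Let coord_digit (s : R) : `|s| <= 1 ->
  exists r : 'I_K, `|s - (-1 + r%:R / N%:R)| <= N%:R^-1.
Proof.
rewrite ler_norml => /andP[s1 s2].
have t0 : 0 <= (s + 1) * N%:R by rewrite mulr_ge0// -lerBlDr sub0r.
have /andP[r1 r2] := truncn_itv t0; set r := Num.truncn _ in r1 r2.
have rK : (r < K)%N.
  rewrite ltnS -(ler_nat R) (le_trans r1)// -muln2 natrM mulrC.
  by rewrite ler_wpM2l//; lra.
exists (Ordinal rK) => /=.
have -> : s - (-1 + r%:R / N%:R) = ((s + 1) * N%:R - r%:R) / N%:R.
  by field; rewrite gt_eqF.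
rewrite normrM normfV (ger0_norm (ltW N0)) ler_piMl ?invr_ge0//.
rewrite ger0_norm ?subr_ge0// lerBlDl.
by move: r2; rewrite -natr1 => /ltW.
Qed.

Let cells_cover x : S x -> exists a (r : 'I_K), cell a r x.
Proof.
move=> Sx; have /choice[dig digP] := fun l => coord_digit (S_box l Sx).
exists [ffun t : D => dig (val t)], (dig j); split => //.
apply: norm_le_coord => [|l]; first by rewrite invr_ge0 ltW.
rewrite !mxE; case: insubP => [t lD lt|] /=.
  rewrite ffunE lt; move: lD => /andP[_ /negbTE lj].
  by rewrite lj ?andbF mulr0 addr0.
rewrite negb_and !negbK => /orP[/eqP ->|/eqP ->].
  rewrite (negbTE (_ : i != j)) 1?eq_sym// ?andbF mulr0 addr0 S_face//.
  by rewrite subrr normr0 invr_ge0 ltW.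
by rewrite eqxx /= mulr1.
Qed.

Variable M : nat.
Hypothesis M_large : 4 * L + 1 <= eta * M%:R.

Let step : R := M%:R / N%:R.

Let M0 : 0 < M%:R :> R.
Proof.
rewrite -(pmulr_rgt0 _ eta_gt0) (lt_le_trans _ M_large)//.
by rewrite ltr_pwDr// mulr_ge0.
Qed.

Let second_diff_ge0 x : 0 <= second_diff x step.
Proof. by rewrite subr_ge0 w_convex. Qed.

(** A cell that contains a kink shows it at its node: moving by 1 / N costs
4 L / N at most, against a second difference of at least eta M / N. *)
Let second_diff_node a r : cell a r !=set0 ->
  1 <= N%:R * second_diff (node a r) step.
Proof.
move=> [x [Sx xa]]; set y := node a r.
have step0 : 0 < step by rewrite divr_gt0.
have near h : `|w (x + h) - w (y + h)| <= L / N%:R.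
  apply: le_trans (w_lip _ _) _; rewrite ler_wpM2l//.
  by rewrite opprD addrACA subrr addr0.
have := near (step *: e); rewrite ler_norml => /andP[_ h1].
have := near (- (step *: e)); rewrite ler_norml => /andP[_ h2].
have := near 0; rewrite !addr0 ler_norml => /andP[h3 _].
have h := S_kink Sx step0.
have hy : eta * step - 4 * (L / N%:R) <= second_diff y step.
  by rewrite /second_diff; lra.
apply: (@le_trans _ _ (N%:R * (eta * step - 4 * (L / N%:R)))); last first.
  by rewrite ler_pM2l.
have -> : N%:R * (eta * step - 4 * (L / N%:R)) = eta * M%:R - 4 * L.
  by rewrite /step; field; rewrite gt_eqF.
by rewrite lerBrDl.
Qed.

(** Along a line the second differences with step M / N are shifted differences
of first differences, so they telescope. *)
Let line_sum a :
  \sum_(r < K) second_diff (node a r) step <= M%:R * (2 * (L * step)).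
Proof.
pose h (s : nat) := w (base a + ((s%:R - M%:R) / N%:R) *: e).
pose jump s := h (s + M)%N - h s.
have jump_le s : `|jump s| <= L * step.
  apply: le_trans (w_shift _ _ _) _; rewrite ler_wpM2l//.
  have -> : ((s + M)%:R - M%:R) / N%:R - (s%:R - M%:R) / N%:R = step.
    by rewrite natrD /step; field; rewrite gt_eqF.
  by rewrite ger0_norm// divr_ge0// ltW.
apply: le_trans (sum_shift_diff_le K M jump_le).
rewrite big_mkord le_eqVlt; apply/orP; left; apply/eqP.
apply: eq_bigr => r _; rewrite /second_diff /jump /h /node -!addrA -scalerBl -scalerDl.
have -> : r%:R / N%:R + step = ((r + M + M)%:R - M%:R) / N%:R.
  by rewrite /step !natrD; field; rewrite gt_eqF.
have -> : r%:R / N%:R - step = (r%:R - M%:R) / N%:R.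
  by rewrite /step; field; rewrite gt_eqF.
have -> : r%:R / N%:R = ((r + M)%:R - M%:R) / N%:R :> R.
  by rewrite !natrD; field; rewrite gt_eqF.
ring.
Qed.

Let wgt := hausdorff_const R n.-1 * (n%:R * (C * (2 / N%:R))) ^+ n.-1.

Let wgt_ge0 : 0 <= wgt.
Proof.
by rewrite mulr_ge0 ?hausdorff_const_ge0// exprn_ge0// mulr_ge0// mulr_ge0.
Qed.

Let cell_image_diam a r x y : (phi @` cell a r) x -> (phi @` cell a r) y ->
  `|x - y| <= C * (2 / N%:R).
Proof.
move=> [x' [Sx x'a] <-] [y' [Sy y'a] <-].
apply: le_trans (phi_lip Sx Sy) _; rewrite ler_wpM2l//.
rewrite -(subrKA (node a r)) (le_trans (ler_normD _ _))//.
by rewrite mulrDl !mul1r lerD// distrC.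
Qed.

(** The weight of a cell is charged to the second difference at its node, which
is at least 1 / N for a cell that meets S and nonnegative by convexity otherwise;
this replaces counting cells. *)
Lemma hausdorff_pre_kinks_grid (delta : R) : n%:R * (C * (2 / N%:R)) <= delta ->
  (hausdorff_pre n.-1 delta (phi @` S) <=
   (wgt * N%:R * (K ^ n.-2)%:R * (M%:R * (2 * (L * step))))%:E)%E.
Proof.
move=> Ndelta; pose c (p : {ffun D -> 'I_K} * 'I_K) := phi @` cell p.1 p.2.
apply: (@le_trans _ _ (\sum_p hausdorff_weight n.-1 (c p))%E).
  apply: hausdorff_pre_finite_cover => [_ [x Sx <-]|p].
    by have [a [r xc]] := cells_cover Sx; exists (a, r) => //; exists x.
  apply: le_trans (ediam_le (@cell_image_diam _ _)) _.
  by rewrite lee_fin.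
apply: (@le_trans _ _
    (\sum_(p : {ffun D -> 'I_K} * 'I_K) (wgt * N%:R * second_diff (node p.1 p.2) step)%:E)%E).
  apply: lee_sum => p _; have [cp0|cp0] := eqVneq (c p) set0.
    by rewrite cp0 hausdorff_weight0 lee_fin mulr_ge0// mulr_ge0// ltW.
  apply: le_trans (hausdorff_weight_le _ _ (@cell_image_diam _ _)) _.
    by rewrite mulr_ge0// divr_ge0// ltW.
  rewrite lee_fin -/wgt -mulrA ler_peMr// second_diff_node//.
  by have /set0P[_ [x xp _]] := cp0; exists x.
rewrite sumEFin lee_fin -mulr_sumr -[leRHS]mulrA ler_wpM2l//.
  by rewrite mulr_ge0// ltW.
rewrite -(pair_bigA _ (fun a (r : 'I_K) => second_diff (node a r) step))/=.
apply: (@le_trans _ _ (\sum_(a : {ffun D -> 'I_K}) M%:R * (2 * (L * step)))).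
  by apply: ler_sum => a _; exact: line_sum.
by rewrite sumr_const card_ffun card_ord card_D [leRHS]mulr_natl.
Qed.

End grid.

(** The bound of the previous lemma is of order
N^-(n-1) N N^(n-2) N^-1, hence tends to 0 with 1 / N. *)
Lemma hausdorff_kinks_hyperplane0 : hausdorff_outer n.-1 (phi @` S) = 0%E.
Proof.
apply: hausdorff_outer_eq0 => delta err delta0 err0.
(* M makes the kink eta M / N exceed the oscillation 4 L / N by 1 / N *)
pose M := (Num.truncn ((4 * L + 1) / eta)).+1.
have M_large : 4 * L + 1 <= eta * M%:R.
  rewrite [leRHS]mulrC -ler_pdivrMr// ltW//.
  have /andP[_] // : (Num.truncn ((4 * L + 1) / eta))%:R <= (4 * L + 1) / eta < M%:R.
  by apply: truncn_itv; rewrite divr_ge0 ?(ltW eta_gt0)// addr_ge0// mulr_ge0.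
have n2 : n.-1 = n.-2.+1.
  case: (n) i j ij => [|[|//]]; first by case.
  by move=> i' j'; rewrite (ord1 i') (ord1 j') eqxx.
set c1 := n%:R * (C * 2).
have c10 : 0 <= c1 by rewrite mulr_ge0// mulr_ge0.
set B0 := hausdorff_const R n.-1 * c1 ^+ n.-1 * (2 * M%:R ^+ 2 * L).
have B00 : 0 <= B0.
  apply: mulr_ge0; last by rewrite mulr_ge0// mulr_ge0// exprn_ge0.
  by apply: mulr_ge0; [exact: hausdorff_const_ge0|exact: exprn_ge0].
(* 3 bounds (2 N + 1) / N, the nodes on a side relative to N *)
set A0 := B0 * 3 ^+ n.-2.
have A00 : 0 <= A0 by rewrite mulr_ge0// exprn_ge0.
pose m := Num.max (c1 / delta) (A0 / err).
pose N := (Num.truncn m).+1.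
have m0 : 0 <= m by rewrite le_max divr_ge0 ?orbT// ltW.
have mN : m < N%:R by have /andP[] := truncn_itv m0.
have N0 : 0 < N%:R :> R by [].
have c1N : n%:R * (C * (2 / N%:R)) <= delta.
  have -> : n%:R * (C * (2 / N%:R)) = c1 / N%:R by rewrite /c1; ring.
  rewrite ler_pdivrMr// [leRHS]mulrC -ler_pdivrMr// ltW// (le_lt_trans _ mN)//.
  by rewrite le_max lexx.
apply: le_trans (@hausdorff_pre_kinks_grid N _ M M_large delta c1N) _ => //.
rewrite lee_fin; apply: (@le_trans _ _ (A0 / N%:R)); last first.
  rewrite ler_pdivrMr// [leRHS]mulrC -ler_pdivrMr// ltW// (le_lt_trans _ mN)//.
  by rewrite le_max lexx orbT.
have KN : (N.*2.+1)%:R / N%:R <= 3 :> R.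
  rewrite ler_pdivrMr// -natrM ler_nat mulSn -muln2 mulnC -add1n leq_add2r.
  by rewrite /N.
apply: (@le_trans _ _ (B0 * ((N.*2.+1)%:R / N%:R) ^+ n.-2 / N%:R)); last first.
  by rewrite ler_wpM2r// ler_wpM2l ?lerXn2r// ?nnegrE ?divr_ge0.
have -> : n%:R * (C * (2 / N%:R)) = c1 / N%:R by rewrite /c1; ring.
rewrite /B0 n2 le_eqVlt; apply/orP; left; apply/eqP.
rewrite natrX !exprMn !exprVn !exprS.
by field; rewrite expf_neq0// gt_eqF.
Qed.

End kinks_on_hyperplane.

(** * Norms and their gradients *)

Section norms.
Variables (R : realType) (n : nat) (N : 'rV[R]_n -> R).
Hypothesis N_norm : is_norm N.
Local Notation V := 'rV[R]_n.
Implicit Types x y : V.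

Lemma is_norm0 : N 0 = 0.
Proof. by rewrite -(scale0r (0 : V)) (is_normZ N_norm) normr0 mul0r. Qed.

Lemma is_normN x : N (- x) = N x.
Proof. by rewrite -scaleN1r (is_normZ N_norm) normrN normr1 mul1r. Qed.

Lemma is_norm_ge0 x : 0 <= N x.
Proof.
have := is_normD N_norm x (- x); rewrite subrr is_norm0 is_normN -mulr2n.
by rewrite pmulrn_lge0.
Qed.

Lemma is_norm_sum (I : Type) (r : seq I) (F : I -> V) :
  N (\sum_(i <- r) F i) <= \sum_(i <- r) N (F i).
Proof.
elim/big_ind2 : _ => [|x a y b xa yb|//]; first by rewrite is_norm0.
by rewrite (le_trans (is_normD N_norm _ _))// lerD.
Qed.

Lemma is_norm_bounded : exists2 C, 0 < C & forall x, N x <= C * `|x|.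
Proof.
exists (1 + \sum_(j < n) N (delta_mx 0 j)).
  by rewrite ltr_pwDl// sumr_ge0// => j _; exact: is_norm_ge0.
move=> x; rewrite {1}(row_sum_delta x) (le_trans (is_norm_sum _ _))//.
apply: (@le_trans _ _ (\sum_(j < n) N (delta_mx 0 j) * `|x|)).
  apply: ler_sum => j _; rewrite (is_normZ N_norm) mulrC.
  by rewrite ler_wpM2l ?is_norm_ge0// coord_le_norm.
by rewrite -mulr_suml ler_wpM2r// lerDr.
Qed.

Lemma is_norm_distl x y : `|N x - N y| <= N (x - y).
Proof.
have one a b : N a - N b <= N (a - b).
  by rewrite lerBlDr (le_trans _ (is_normD N_norm _ _))// subrK.
by rewrite ler_norml one andbT lerNl opprB -(is_normN (x - y)) opprB one.
Qed.

Lemma is_norm_lipschitz :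
  exists2 C, 0 < C & forall x y, `|N x - N y| <= C * `|x - y|.
Proof.
have [C C0 NC] := is_norm_bounded; exists C => // x y.
exact: le_trans (is_norm_distl x y) (NC _).
Qed.

Lemma lipschitz_continuous (f : V -> R) (C : R) :
  (forall x y, `|f x - f y| <= C * `|x - y|) -> continuous f.
Proof.
move=> fC x A /nbhs_ballP[e /= e0 eA].
have C0 : 0 < `|C| + 1 by rewrite ltr_wpDl.
apply/nbhs_ballP; exists (e / (`|C| + 1)); first exact: divr_gt0.
move=> y; rewrite -ball_normE /= => xy; apply: eA; rewrite -ball_normE /=.
apply: le_lt_trans (fC _ _) _; apply: (@le_lt_trans _ _ ((`|C| + 1) * `|x - y|)).
  by rewrite ler_wpM2r// (le_trans (ler_norm _))// lerDl.
by rewrite mulrC -ltr_pdivlMr.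
Qed.

Lemma closed_level (f : V -> R) (c : R) : continuous f -> closed [set x | f x = c].
Proof.
move=> cf; apply: (@closed_comp _ _ f [set c]) => [x _|]; first exact: cf.
exact: (@closed_eq R c).
Qed.

Lemma is_norm_continuous : continuous N.
Proof. by have [C _ NC] := is_norm_lipschitz; exact: lipschitz_continuous NC. Qed.

(** By compactness of the unit sphere of the sup norm. *)
Lemma is_norm_lower_bound : exists2 c, 0 < c & forall x, c * `|x| <= N x.
Proof.
pose S := [set x : V | `|x| = 1].
have [S0|/set0P S0] := eqVneq S set0.
  exists 1 => // x; have [->|x0] := eqVneq x 0; first by rewrite normr0 mulr0 is_norm_ge0.
  have : S (`|x|^-1 *: x).
    by rewrite /S/= normrZ normfV normr_id mulVf// normr_eq0.
  by rewrite S0.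
have cS : compact S.
  apply: bounded_closed_compact.
    by exists 1; split; [exact: num_real|move=> M M1 x /= ->; exact: ltW].
  by apply: closed_level => x; exact: norm_continuous.
have [z zS Nz] := EVT_min_rV S0 cS (continuous_subspaceT is_norm_continuous).
have z1 : `|z| = 1 by rewrite inE in zS.
exists (N z).
  rewrite lt_neqAle is_norm_ge0 andbT eq_sym; apply/eqP => /(is_norm_eq0 N_norm) z0.
  by move: z1; rewrite z0 normr0 => /eqP; rewrite eq_sym oner_eq0.
move=> x; have [->|x0] := eqVneq x 0; first by rewrite normr0 mulr0 is_norm_ge0.
have nx : 0 < `|x| by rewrite normr_gt0.
have := Nz (`|x|^-1 *: x); rewrite inE /S /= normrZ normfV normr_id mulVf ?gt_eqF//.
move=> /(_ erefl); rewrite (is_normZ N_norm) normfV normr_id.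
by rewrite ler_pdivlMl// mulrC.
Qed.

Lemma unit_sphere_neq0 x : unit_sphere N x -> x != 0.
Proof.
move=> Nx; apply/eqP => x0; move: Nx; rewrite /unit_sphere/= x0 is_norm0.
by move/eqP; rewrite eq_sym oner_eq0.
Qed.

Lemma closed_unit_sphere : closed (unit_sphere N).
Proof. exact: closed_level is_norm_continuous. Qed.

Lemma compact_unit_sphere : compact (unit_sphere N).
Proof.
have [c c0 Nc] := is_norm_lower_bound.
apply: bounded_closed_compact; last exact: closed_unit_sphere.
exists c^-1; split=> [|M M1 x /= Nx]; first exact: num_real.
by rewrite (le_trans _ (ltW M1))// -(mul1r c^-1) ler_pdivlMr// mulrC (le_trans (Nc _))// Nx.
Qed.

Section gradient.
Hypothesis N_C1 : C1_away_from_0 N.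

Lemma derive_gradient x y : x != 0 -> 'D_y N x = dotp y (gradient N x).
Proof.
move=> /N_C1[Nx _]; rewrite {1}(row_sum_delta y) deriveE// linear_sum/=.
apply: eq_bigr => j _; rewrite linearZ/= mxE deriveE//.
Qed.

Lemma derive_at_right x y : x != 0 ->
  'D_y N x = lim (h^-1 * (N (h *: y + x) - N x) @[h --> (0 : R)^'+]) /\
  cvg (h^-1 * (N (h *: y + x) - N x) @[h --> (0 : R)^'+]).
Proof.
move=> /N_C1[Nx _]; have dN : derivable N x y by exact: diff_derivable.
split; first exact: (cvg_at_rightE (fun h : R => h^-1 *: ((N \o shift x) (h *: y) - N x))).
by move: dN => /cvg_ex[l /cvg_dnbhs_at_right Nl]; apply/cvg_ex; exists l.
Qed.

Lemma gradient_le_norm x y : x != 0 -> dotp y (gradient N x) <= N y.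
Proof.
move=> x0; rewrite -derive_gradient//.
have [-> cN] := derive_at_right y x0.
apply: (limr_le cN); near=> h.
have h0 : 0 < h by near: h; exact: nbhs_right_gt.
rewrite ler_pdivrMl// lerBlDr (le_trans (is_normD N_norm _ _))//.
by rewrite (is_normZ N_norm) gtr0_norm.
Unshelve. all: by end_near. Qed.

Lemma dotp_gradient_self x : x != 0 -> dotp x (gradient N x) = N x.
Proof.
move=> x0; apply/eqP; rewrite eq_le gradient_le_norm//= -derive_gradient//.
have [-> cN] := derive_at_right x x0.
apply: (limr_ge cN); near=> h.
have h0 : 0 < h by near: h; exact: nbhs_right_gt.
have -> : h *: x + x = (h + 1) *: x by rewrite scalerDl scale1r.
rewrite ler_pdivlMl// (is_normZ N_norm).
by rewrite ger0_norm ?addr_ge0 ?(ltW h0)// mulrDl mul1r addrK.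
Unshelve. all: by end_near. Qed.

End gradient.
End norms.

(** * Kinks of homogeneous convex functions on a sphere *)

Section kinks_on_sphere.
Variables (R : realType) (n : nat) (N w : 'rV[R]_n -> R) (L : R).
Local Notation V := 'rV[R]_n.
Hypothesis N_norm : is_norm N.
Hypothesis w_lip : forall x y, `|w x - w y| <= L * `|x - y|.
Hypothesis w_convex : forall x h, 2 * w x <= w (x + h) + w (x - h).
Hypothesis w_homog : forall t x, 0 < t -> w (t *: x) = t * w x.

(** For a positively homogeneous convex w this says that p is a subgradient of w
at x; the form without w x + dotp p (z - x) is stable under scaling of x. *)
Definition touches (p x : V) : Prop :=
  (forall z, dotp p z <= w z) /\ dotp p x = w x.

(** The index (i, j, b, k) records the face x_i = (-1)^b, the direction e_j and the
bound 1 / (k + 1) from below for the kink. *)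
Let face_kinks (t : 'I_n * 'I_n * bool * nat) : set V :=
  [set y : V | [/\ y 0 t.1.1.1 = (-1) ^+ t.1.2, forall l, `|y 0 l| <= 1 &
    exists p q, [/\ touches p y, touches q y &
      t.2.+1%:R^-1 <= p 0 t.1.1.2 - q 0 t.1.1.2]]].

Let radial (y : V) := (N y)^-1 *: y.

Let face_kinks_null (t : 'I_n * 'I_n * bool * nat) : t.1.1.2 != t.1.1.1 ->
  hausdorff_outer n.-1 (radial @` face_kinks t) = 0%E.
Proof.
case: t => [[[i j] b] k] /= ij.
have [c c0 Nc] := is_norm_lower_bound N_norm.
have [C C0 NC] := is_norm_lipschitz N_norm.
have face_norm y : face_kinks (i, j, b, k) y -> `|y| = 1.
  move=> [/= yi yl _]; apply/eqP; rewrite eq_le norm_le_coord//=.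
  by rewrite (le_trans _ (coord_le_norm y i))// yi normrX normrN1 expr1n.
have radial_lip x y : face_kinks (i, j, b, k) x -> face_kinks (i, j, b, k) y ->
    `|radial x - radial y| <= (c^-1 + C / (c * c)) * `|x - y|.
  move=> /face_norm x1 /face_norm y1.
  have Nxc : c <= N x by have := Nc x; rewrite x1 mulr1.
  have Nyc : c <= N y by have := Nc y; rewrite y1 mulr1.
  have Nx0 := lt_le_trans c0 Nxc; have Ny0 := lt_le_trans c0 Nyc.
  have -> : radial x - radial y =
      (N x)^-1 *: (x - y) + ((N y - N x) / (N x * N y)) *: y.
    rewrite scalerBr -addrA; congr (_ + _).
    have -> : (N y - N x) / (N x * N y) = (N x)^-1 - (N y)^-1.
      by field; rewrite !gt_eqF.
    by rewrite scalerBl addrA addNr add0r.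
  rewrite (le_trans (ler_normD _ _))// [leRHS]mulrDl lerD// normrZ.
    by rewrite ler_wpM2r// ger0_norm ?invr_ge0 ?(ltW Nx0)// lef_pV2.
  rewrite y1 mulr1 normrM normfV (gtr0_norm (mulr_gt0 Nx0 Ny0)).
  rewrite mulrAC ler_pM// ?invr_ge0 ?(ltW (mulr_gt0 Nx0 Ny0))//.
    by rewrite distrC.
  by rewrite lef_pV2 ?posrE ?mulr_gt0// ler_pM// ltW.
apply: (hausdorff_kinks_hyperplane0 w_lip w_convex ij (_ : 0 < k.+1%:R^-1)
   _ _ _ _ radial_lip) => //.
- by move=> y [yi _ _]; exact: yi.
- by move=> y l [_ yl _]; exact: yl.
- move=> y t [_ _ [p [q [[pw py] [qw qy] pq]]]] t0.
  have := pw (y + t *: delta_mx 0 j); have := qw (y - t *: delta_mx 0 j).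
  rewrite dotpBr dotpDr !dotpZr !dotp_delta py qy => h1 h2.
  apply: (@le_trans _ _ ((p 0 j - q 0 j) * t)); first by rewrite ler_wpM2r// ltW.
  lra.
- by rewrite addr_ge0// ?divr_ge0 ?invr_ge0// ?mulr_ge0// ltW.
Qed.

(** If two subgradients at x agree off the coordinate i with x_i != 0, then they
agree, since both pair with x to w x. Hence the kink at x / |x| is visible in a
direction along the face that contains this point, and the kinks form a countable union
of images of null sets under radial projection. *)
Lemma sphere_kinks_null : hausdorff_outer n.-1 [set x : V | N x = 1 /\
  exists p q, [/\ p != q, touches p x & touches q x]] = 0%E.
Proof.
pose A t := if t.1.1.2 == t.1.1.1 then set0 else radial @` face_kinks t.
have A0 t : hausdorff_outer n.-1 (A t) = 0%E.
  rewrite /A; case: ifPn => [_|]; first exact: hausdorff_outer0.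
  exact: face_kinks_null.
apply/eqP; rewrite eq_le hausdorff_outer_ge0 andbT -(hausdorff_outer_bigcup0 A0).
apply: le_hausdorff_outer => x [Nx [p [q [pq [pw px] [qw qx]]]]].
have x0 : x != 0 by exact: (@unit_sphere_neq0 _ _ N).
have nx : 0 < `|x| by rewrite normr_gt0.
have [i xi] := norm_attained x0.
pose y := `|x|^-1 *: x.
have touch_y r : (forall z, dotp r z <= w z) -> dotp r x = w x -> touches r y.
  by move=> rw rx; split; rewrite // dotpZr rx w_homog// invr_gt0.
have [j ji pqj] : exists2 j, j != i & p 0 j != q 0 j.
  apply: contrapT => pq_eq.
  have pqj j : j != i -> (p - q) 0 j = 0.
    move=> ji; rewrite !mxE; apply/eqP; rewrite subr_eq0; apply/negPn/negP => h.
    by apply: pq_eq; exists j.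
  have : dotp (p - q) x = 0 by rewrite dotpBl px qx subrr.
  rewrite /dotp (bigD1 i)//= big1 ?addr0; last by move=> j ji; rewrite pqj// mul0r.
  move/eqP; rewrite mulf_eq0 => /orP[/eqP pqi|]; last first.
    by rewrite -normr_eq0 -xi gt_eqF.
  move/negP: pq; apply; rewrite -subr_eq0; apply/eqP/rowP => j.
  by have [->|ji] := eqVneq j i; rewrite [RHS]mxE// pqj.
wlog pq_lt : p q pq pqj pw px qw qx / q 0 j < p 0 j.
  move=> th; have [|h|h] := ltgtP (q 0 j) (p 0 j); first exact: (th p q).
    by apply: (th q p) => //; rewrite eq_sym.
  by move: pqj; rewrite h eqxx.
pose k := Num.truncn (p 0 j - q 0 j)^-1.
have k_le : k.+1%:R^-1 <= p 0 j - q 0 j.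
  have d0 : 0 < p 0 j - q 0 j by rewrite subr_gt0.
  rewrite -[leRHS]invrK lef_pV2 ?posrE ?invr_gt0// ltW//.
  have d1 : 0 <= (p 0 j - q 0 j)^-1 by rewrite invr_ge0 ltW.
  by have /andP[] := truncn_itv d1.
exists (i, j, x 0 i < 0, k) => //; rewrite /A /= (negbTE ji).
exists y; last first.
  rewrite /radial /y (is_normZ N_norm) Nx mulr1 normfV normr_id invrK scalerA.
  by rewrite mulfV ?scale1r// gt_eqF.
split => /=.
- rewrite mxE xi; have [xi0|xi0] := ltP (x 0 i) 0.
    by rewrite expr1 ltr0_norm// invrN mulNr mulVf// lt_eqF.
  rewrite expr0 ger0_norm// mulVf//; apply/eqP => xi00.
  by move: nx; rewrite xi xi00 normr0 ltxx.
- move=> l; rewrite mxE normrM normfV normr_id ler_pdivrMl// mulr1.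
  exact: coord_le_norm.
- by exists p, q; split => //; exact: touch_y.
Qed.

End kinks_on_sphere.

(** * Borel sets, continuous functions and infima *)

Section borel_rowvec.
Variables (R : realType) (n : nat).
Local Notation V := 'rV[R]_n.

Lemma open_measurable_rV (G : set V) : open G -> measurable (G : set (borel_rV R n)).
Proof. by move=> oG; apply: sub_sigma_algebra. Qed.

Lemma closed_measurable_rV (F : set V) : closed F -> measurable (F : set (borel_rV R n)).
Proof.
by move=> cF; rewrite -(setCK F); apply: measurableC; apply: open_measurable_rV; exact: closed_openC.
Qed.

Lemma compact_measurable_rV (F : set V) : compact F -> measurable (F : set (borel_rV R n)).
Proof.
by move=> cF; apply: closed_measurable_rV; exact: (compact_closed (@norm_hausdorff _ _)).
Qed.

Lemma relatively_open_measurable (X A : set V) : measurable (X : set (borel_rV R n)) ->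
  A `<=` X ->
  (forall x, A x -> exists2 d : R, 0 < d & forall y, X y -> `|x - y| < d -> A y) ->
  measurable (A : set (borel_rV R n)).
Proof.
move=> mX AX Aopen.
pose G := \bigcup_(xd in [set xd : V * R | 0 < xd.2 /\
  forall y, X y -> `|xd.1 - y| < xd.2 -> A y]) ball xd.1 xd.2.
have -> : A = X `&` G.
  apply/seteqP; split => x; last first.
    by move=> [Xx [[z d] [/= d0 dA]]]; rewrite -ball_normE => /dA; exact.
  move=> Ax; split; first exact: AX.
  have [d d0 dA] := Aopen _ Ax; exists (x, d) => //=; exact: ballxx.
apply: measurableI => //; apply: open_measurable_rV; apply: bigcup_open => -[z d] [/= d0 _].
exact: ball_open.
Qed.

Definition continuous_on (X : set V) (u : V -> R) :=
  forall x, X x -> forall e : R, 0 < e ->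
  exists2 d : R, 0 < d & forall y, X y -> `|x - y| < d -> `|u x - u y| <= e.

Lemma continuous_on_measurable (X : set V) (u : V -> R) :
  measurable (X : set (borel_rV R n)) -> continuous_on X u ->
  measurable_fun (X : set (borel_rV R n)) u.
Proof.
move=> mX cu; apply: (measurability _ (measurable_realfun.RGenInftyO.measurableE R)) => _ [_ [a ->] <-].
apply: (relatively_open_measurable mX); first by move=> x [].
move=> x [Xx]; rewrite /= in_itv/= => ua.
have ua0 : 0 < (a - u x) / 2 by rewrite divr_gt0// subr_gt0.
have [d d0 du] := cu _ Xx _ ua0; exists d => // y Xy xy; split => //=.
rewrite in_itv/=; have := du y Xy xy; rewrite ler_norml => /andP[h _]; lra.
Qed.

(** The sublevel sets of g on the compact set generate a filter; a cluster point of
it is a point where g is nonpositive. *)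
Lemma continuous_on_closed_inf (Y K : set V) (g : V -> R) : compact Y -> closed K ->
  continuous_on Y g -> (forall e : R, 0 < e -> exists2 y, (Y `&` K) y & g y < e) ->
  exists2 y, (Y `&` K) y & g y <= 0.
Proof.
move=> cY cK cg small.
have cYK : compact (Y `&` K) by exact: compact_closedI.
pose F := [set A : set V | exists2 e : R, 0 < e & (Y `&` K) `&` [set y | g y < e] `<=` A].
have FF : ProperFilter F.
  apply: Build_ProperFilter_ex.
    by move=> A [e e0 eA]; have [y Yy ye] := small _ e0; exists y; exact: eA.
  split; first by exists 1.
    move=> A1 A2 [e1 e10 eA1] [e2 e20 eA2]; exists (Num.min e1 e2).
      by rewrite lt_min e10.
    by move=> y [Yy]; rewrite /= lt_min => /andP[h1 h2]; split; [apply: eA1|apply: eA2].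
  by move=> A1 A2 A12 [e e0 eA]; exists e => //; exact: subset_trans A12.
have FYK : F (Y `&` K) by exists 1 => // y [].
have [y [YKy cly]] := cYK F FF FYK.
exists y => //; rewrite leNgt; apply/negP => gy.
have gy2 : 0 < g y / 2 by rewrite divr_gt0.
have [d d0 dg] := cg y YKy.1 _ gy2.
have FA : F ((Y `&` K) `&` [set y' | g y' < g y / 2]) by exists (g y / 2).
have [z [[[Yz Kz] /= gz]]] := cly _ _ FA (nbhsx_ballx y d d0).
rewrite -ball_normE => /(dg _ Yz); rewrite ler_norml => /andP[_ h]; lra.
Qed.

Variables (m : {measure set (borel_rV R n) -> \bar R}) (X : set V).
Hypothesis mX : measurable (X : set (borel_rV R n)).
Hypothesis finX : (m X < +oo)%E.

Definition bounded_on (u : V -> R) := exists B, forall x, X x -> `|u x| <= B.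

Lemma bounded_on_integrable (u : V -> R) :
  measurable_fun (X : set (borel_rV R n)) u -> bounded_on u ->
  m.-integrable X (EFin \o u).
Proof.
move=> mu [B uB]; apply: measurable_bounded_integrable => //.
exists B; split => [|M BM x Xx]; first exact: num_real.
by rewrite /= (le_trans (uB x Xx))// ltW.
Qed.

Lemma Rintegral_le_add (u u' : V -> R) (e : R) :
  measurable_fun (X : set (borel_rV R n)) u -> bounded_on u ->
  measurable_fun (X : set (borel_rV R n)) u' -> bounded_on u' ->
  (forall x, X x -> u x <= u' x + e) ->
  \int[m]_(x in X) u x <= \int[m]_(x in X) u' x + e * fine (m X).
Proof.
move=> mu bu mu' bu' uu'.
rewrite -(Rintegral_cst _ mX) -RintegralD//; last 2 first.
- exact: bounded_on_integrable.
- by apply: bounded_on_integrable => //; exists `|e|.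
apply: le_Rintegral => //; first exact: bounded_on_integrable.
apply: bounded_on_integrable; first exact: measurable_realfun.measurable_funD.
case: bu' => B' h; exists (B' + `|e|) => x Xx.
by rewrite (le_trans (ler_normD _ _))// lerD// h.
Qed.

End borel_rowvec.

Section infima.
Variables (R : realType) (T : Type) (A : set T).
Hypothesis A0 : A !=set0.
Implicit Types f g : T -> R.

Definition minorized f := exists b, forall y, A y -> b <= f y.

Lemma inf_image_le f y : minorized f -> A y -> inf (f @` A) <= f y.
Proof. by move=> [b fb] Ay; apply: ge_inf; [exists b => _ [z Az <-]; exact: fb|exists y]. Qed.

Lemma le_inf_image f b : (forall y, A y -> b <= f y) -> b <= inf (f @` A).
Proof. by move=> fb; apply: lb_le_inf => [|_ [z Az <-]]; [exact: image_nonempty|exact: fb]. Qed.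

(** Taking infima is 1-Lipschitz for the uniform distance: the regularity of all
conjugate functions below comes from here. *)
Lemma inf_image_dist f g e : minorized f -> minorized g ->
  (forall y, A y -> `|f y - g y| <= e) -> `|inf (f @` A) - inf (g @` A)| <= e.
Proof.
move=> mf mg fg.
have one (f' g' : T -> R) : minorized g' -> (forall y, A y -> `|f' y - g' y| <= e) ->
    inf (g' @` A) - inf (f' @` A) <= e.
  move=> mg' fg'; rewrite lerBlDl -lerBlDr; apply: le_inf_image => y Ay.
  rewrite lerBlDr; apply: le_trans (inf_image_le mg' Ay) _.
  by have := fg' y Ay; rewrite ler_norml => /andP[h _]; lra.
have gf y : A y -> `|g y - f y| <= e by move=> Ay; rewrite distrC; exact: fg.
have h1 := one f g mg fg; have h2 := one g f mf gf.
by rewrite ler_norml; apply/andP; split; lra.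
Qed.

End infima.

(** * Dual transport problem *)

Section kantorovich.
Variables (R : realType) (n : nat).
Local Notation V := 'rV[R]_n.
Variables (X Y : set V) (k : V -> V -> R) (L B : R) (x0 : V).
Variables (nu mu : {measure set (borel_rV R n) -> \bar R}).
Hypothesis (cX : compact X) (cY : compact Y) (Xx0 : X x0) (Y0 : Y !=set0).
Hypothesis L_ge0 : 0 <= L.
Hypothesis k_bounded : forall x y, X x -> Y y -> `|k x y| <= B.
Hypothesis k_lip : forall x x' y, X x -> X x' -> Y y ->
  `|k x y - k x' y| <= L * `|x - x'|.
Hypothesis k_cont : forall y, Y y -> forall e : R, 0 < e ->
  exists2 d : R, 0 < d & forall y', Y y' -> `|y - y'| < d ->
    forall x, X x -> `|k x y - k x y'| <= e.
Hypothesis nu_fin : (nu X < +oo)%E.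
Hypothesis mass_eq : nu X = mu Y.

Let X0 : X !=set0. Proof. by exists x0. Qed.

Let mu_fin : (mu Y < +oo)%E. Proof. by rewrite -mass_eq. Qed.

Let mX : measurable (X : set (borel_rV R n)).
Proof. exact: compact_measurable_rV. Qed.

Let mY : measurable (Y : set (borel_rV R n)).
Proof. exact: compact_measurable_rV. Qed.

Let mfun (A : set V) (u : V -> R) := measurable_fun (A : set (borel_rV R n)) u.

Definition lipschitz_on (u : V -> R) :=
  forall x x', X x -> X x' -> `|u x - u x'| <= L * `|x - x'|.

(** The conjugates for the cost k: conj_left v is the largest u, and
conj_right u the largest v, that satisfies u x + v y <= k x y. *)
Definition conj_left (v : V -> R) x := inf ((fun y => k x y - v y) @` Y).
Definition conj_right (u : V -> R) y := inf ((fun x => k x y - u x) @` X).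

Let X_diam : exists2 D, 0 <= D & forall x x', X x -> X x' -> `|x - x'| <= D.
Proof.
have [M [_ XM]] := compact_bounded cX.
have XM' x : X x -> `|x| <= `|M| + 1.
  by move=> Xx; apply: XM => //; rewrite ltr_pwDr// ler_norm.
exists ((`|M| + 1) + (`|M| + 1)); first by rewrite !addr_ge0.
by move=> x x' Xx Xx'; rewrite (le_trans (ler_normB _ _))// lerD ?XM'.
Qed.

Let lip_bounded u : lipschitz_on u -> bounded_on X u.
Proof.
move=> ul; have [D D0 XD] := X_diam; exists (`|u x0| + L * D) => x Xx.
rewrite -(subrK (u x0) (u x)) addrC (le_trans (ler_normD _ _))// lerD2l.
by rewrite (le_trans (ul _ _ Xx Xx0))// ler_wpM2l// XD.
Qed.

Let lip_continuous u : lipschitz_on u -> continuous_on X u.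
Proof.
move=> ul x Xx e e0; exists (e / (L + 1)) => [|y Xy xy].
  by rewrite divr_gt0// ltr_wpDl.
apply: le_trans (ul _ _ Xx Xy) _; apply: (@le_trans _ _ ((L + 1) * `|x - y|)).
  by rewrite ler_wpM2r// lerDl.
by rewrite mulrC -ler_pdivlMr ?ltW// ltr_wpDl.
Qed.

Let lip_measurable u : lipschitz_on u -> mfun X u.
Proof. by move=> ul; apply: continuous_on_measurable => //; exact: lip_continuous. Qed.

Let minor_left v x : bounded_on Y v -> X x -> minorized Y (fun y => k x y - v y).
Proof.
move=> [b vb] Xx; exists (- B - b) => y Yy.
have := k_bounded Xx Yy; have := vb y Yy; rewrite !ler_norml => /andP[_ h1] /andP[h2 _].
exact: lerB.
Qed.

Let minor_right u y : bounded_on X u -> Y y -> minorized X (fun x => k x y - u x).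
Proof.
move=> [b ub] Yy; exists (- B - b) => x Xx.
have := k_bounded Xx Yy; have := ub x Xx; rewrite !ler_norml => /andP[_ h1] /andP[h2 _].
exact: lerB.
Qed.

Let conj_left_le v x y : bounded_on Y v -> X x -> Y y -> conj_left v x <= k x y - v y.
Proof. by move=> bv Xx; apply: inf_image_le; exact: minor_left. Qed.

Let conj_right_le u x y : bounded_on X u -> X x -> Y y -> conj_right u y <= k x y - u x.
Proof. by move=> bu Xx Yy; apply: (inf_image_le (minor_right bu Yy)). Qed.

Let conj_left_lip v : bounded_on Y v -> lipschitz_on (conj_left v).
Proof.
move=> bv x x' Xx Xx'; apply: inf_image_dist => //; try exact: minor_left.
by move=> y Yy; rewrite opprB addrA subrK k_lip.
Qed.

Let conj_right_continuous u : bounded_on X u -> continuous_on Y (conj_right u).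
Proof.
move=> bu y Yy e e0; have [d d0 kd] := k_cont Yy e0; exists d => // y' Yy' yy'.
apply: inf_image_dist => //; try exact: minor_right.
by move=> x Xx; rewrite opprB addrA subrK kd.
Qed.

Let conj_right_bound u b : (forall x, X x -> `|u x| <= b) ->
  forall y, Y y -> `|conj_right u y| <= B + b.
Proof.
move=> ub y Yy; have bu : bounded_on X u by exists b.
rewrite ler_norml; apply/andP; split.
  apply: le_inf_image => // x Xx.
  have := k_bounded Xx Yy; have := ub x Xx; rewrite !ler_norml => /andP[_ h1] /andP[h2 _].
  by rewrite opprD lerB.
apply: le_trans (conj_right_le bu Xx0 Yy) _.
have := k_bounded Xx0 Yy; have := ub x0 Xx0; rewrite !ler_norml => /andP[h1 _] /andP[_ h2].
by rewrite lerD// lerNl.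
Qed.

Definition admissible (u v : V -> R) := [/\ lipschitz_on u, mfun Y v, bounded_on Y v &
  forall x y, X x -> Y y -> u x + v y <= k x y].

Let adm_right u : lipschitz_on u -> admissible u (conj_right u).
Proof.
move=> ul; have bu := lip_bounded ul; split => //.
- by apply: continuous_on_measurable => //; exact: conj_right_continuous.
- by have [b ub] := bu; exists (B + b); exact: conj_right_bound.
- by move=> x y Xx Yy; rewrite addrC -lerBrDr; exact: conj_right_le.
Qed.

Let adm_left v : mfun Y v -> bounded_on Y v -> admissible (conj_left v) v.
Proof.
move=> mv bv; split => //; first exact: conj_left_lip.
by move=> x y Xx Yy; rewrite -lerBrDr; exact: conj_left_le.
Qed.

Definition dual (u v : V -> R) : R :=
  \int[nu]_(x in X) u x + \int[mu]_(y in Y) v y.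

Let mass := fine (nu X).

Let mass_ge0 : 0 <= mass. Proof. by rewrite fine_ge0. Qed.

Let dual_le u v u' v' e1 e2 : mfun X u -> bounded_on X u -> mfun Y v -> bounded_on Y v ->
  mfun X u' -> bounded_on X u' -> mfun Y v' -> bounded_on Y v' ->
  (forall x, X x -> u x <= u' x + e1) -> (forall y, Y y -> v y <= v' y + e2) ->
  dual u v <= dual u' v' + (e1 + e2) * mass.
Proof.
move=> *; rewrite mulrDl addrACA lerD//; first exact: Rintegral_le_add.
by rewrite /mass mass_eq; exact: Rintegral_le_add.
Qed.

(** The constants e1 and e2 may have any sign; with e1 = - e2 this is invariance of
the dual functional under (u + c, v - c), due to the equality of masses. *)
Let adm_dual_le u v u' v' e1 e2 : admissible u v -> admissible u' v' ->
  (forall x, X x -> u x <= u' x + e1) -> (forall y, Y y -> v y <= v' y + e2) ->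
  dual u v <= dual u' v' + (e1 + e2) * mass.
Proof.
move=> [ul mv bv _] [ul' mv' bv' _]; apply: dual_le => //.
- exact: lip_measurable.
- exact: lip_bounded.
- exact: lip_measurable.
- exact: lip_bounded.
Qed.

(** Normalized by u x0 = 0 and extended by 0 off X, the competitors are bounded
everywhere by L times the diameter of X, hence lie in a compact product of intervals. *)
Section maximizer.
Variable D : R.
Hypothesis D0 : 0 <= D.
Hypothesis XD : forall x x', X x -> X x' -> `|x - x'| <= D.
Let C := L * D.

Let C0 : 0 <= C. Proof. exact: mulr_ge0. Qed.

Let cls : set (V -> R) := [set u | lipschitz_on u /\ forall x, `|u x| <= C].

Let adm_cls u v : admissible u v ->
  exists2 u', cls u' & dual u v <= dual u' (conj_right u').
Proof.
move=> uv; have [ul mv bv uvk] := uv; pose a := u x0.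
pose u' x := if x \in X then u x - a else 0.
have u'E x : X x -> u' x = u x - a by move=> Xx; rewrite /u' mem_set.
have ul' : lipschitz_on u'.
  by move=> x x' Xx Xx'; rewrite !u'E// opprB addrA subrK ul.
exists u'.
  split => // x; rewrite /u'; case: ifPn => [|_]; last by rewrite normr0.
  by rewrite inE => Xx; rewrite (le_trans (ul _ _ Xx Xx0))// ler_wpM2l// XD.
(* subtracting a from u is compensated by adding a to v *)
rewrite -[leRHS]addr0 -(mul0r mass) -(subrr a).
apply: adm_dual_le => //; first exact: adm_right.
  by move=> x Xx; rewrite u'E// subrK.
move=> y Yy; rewrite lerBrDr; apply: le_inf_image => // x Xx.
by rewrite u'E//; have := uvk _ _ Xx Yy; lra.
Qed.

Let values := [set dual u (conj_right u) | u in cls].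

Let values_sup : has_sup values.
Proof.
split.
  have cls0 : cls (fun=> 0) by split => [x x' _ _|x]; rewrite ?subrr normr0// mulr_ge0.
  by exists (dual (fun=> 0) (conj_right (fun=> 0))), (fun=> 0).
exists (dual (fun=> 0) (fun=> 0) + (C + (B + C)) * mass) => _ [u [ul uC] <-].
have [_ mv bv _] := adm_right ul.
have b0 (A : set V) : bounded_on A (fun=> 0 : R) by exists 0 => x _; rewrite normr0.
apply: dual_le => //.
- exact: lip_measurable.
- exact: lip_bounded.
- exact: measurable_cst.
- exact: measurable_cst.
- by move=> x _; rewrite add0r (le_trans (ler_norm _)).
- by move=> y Yy; rewrite add0r (le_trans (ler_norm _))// conj_right_bound.
Qed.

Let finite_net (e : R) : 0 < e ->
  exists s : seq V, forall x, X x -> exists2 z, z \in s /\ X z & `|x - z| < e.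
Proof.
move=> e0; move: cX; rewrite compact_cover => /(_ V X (fun z => ball z e)).
move=> [z Xz|x Xx|s sX Xs]; first exact: ball_open.
  by exists x => //; exact: ballxx.
exists (finmap.enum_fset s) => x /Xs[z /= zs]; rewrite -ball_normE /= => zx.
by exists z; [split => //; have := sX _ zs; rewrite inE|rewrite distrC].
Qed.

(** A cluster point of a maximizing sequence in the product topology is only close to
terms of the sequence on finite sets; on a finite net of X, the common Lipschitz
constant makes this uniform closeness, for which the dual functional is continuous. *)
Let maximizer_cls : exists2 u, cls u & sup values <= dual u (conj_right u).
Proof.
have /choice[us usP] : forall m, exists u, cls u /\
    sup values - m.+1%:R^-1 < dual u (conj_right u).
  move=> m; have m0 : 0 < m.+1%:R^-1 :> R by rewrite invr_gt0.
  by have [_ [u ucls <-] h] := sup_adherent m0 values_sup; exists u.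
pose box := [set f : V -> R | forall x, `[- C, C]%classic (f x)].
have cbox : @compact (prod_topology (fun _ : V => R)) box.
  apply: (@tychonoff V (fun=> R) (fun=> `[- C, C]%classic)) => x.
  exact: segment_compact.
pose F : set_system (prod_topology (fun _ : V => R)) := us @ \oo.
have FF : ProperFilter F by exact: fmap_proper_filter.
have Fbox : F box.
  exists 0%N => // m _ x; rewrite /= in_itv/= -ler_norml.
  by have [[_ uC] _] := usP m; exact: uC.
have [u [ubox clu]] := cbox F FF Fbox.
have near_finite (s : seq V) (e : R) (m0 : nat) : 0 < e -> exists2 m, (m0 <= m)%N &
    forall z, z \in s -> `|us m z - u z| < e.
  move=> e0; pose A : set (V -> R) := us @` [set m | (m0 <= m)%N].
  have FA : F A by exists m0 => // m m0m; exists m.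
  have nbs : nbhs (u : prod_topology (fun _ : V => R))
      [set f : V -> R | forall z, z \in s -> `|f z - u z| < e].
    have nbF : Filter (nbhs (u : prod_topology (fun _ : V => R))).
      exact: nbhs_filter.
    elim: s => [|z s IH]; first by apply: filterE => f z; rewrite in_nil.
    have nbz : nbhs (u : prod_topology (fun _ : V => R))
        [set f : V -> R | `|f z - u z| < e].
      apply: (@proj_continuous V (fun=> R) z u [set r : R | `|r - u z| < e]).
      apply/nbhs_ballP; exists e => // r; rewrite -ball_normE /= distrC.
      exact.
    apply: filterS (filterI nbz IH) => f [/= fz fs] z'.
    by rewrite inE => /orP[/eqP ->|/fs].
  by have [_ [[m m0m <-] h]] := clu _ _ FA nbs; exists m.
have uC x : `|u x| <= C by have := ubox x; rewrite /= in_itv/= -ler_norml.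
have ul : lipschitz_on u.
  move=> x x' Xx Xx'; apply/ler_addgt0Pr => e e0.
  have e20 : 0 < e / 2 by rewrite divr_gt0.
  have [m _ hm] := near_finite [:: x; x'] _ 0%N e20.
  have [[usl _] _] := usP m.
  have h1 := hm x (mem_head _ _); have h2 : `|us m x' - u x'| < e / 2.
    by apply: hm; rewrite !inE eqxx orbT.
  have h3 := usl _ _ Xx Xx'; move: h1 h2 h3.
  rewrite !ltr_norml !ler_norml => /andP[a1 a2] /andP[b1 b2] /andP[c1 c2].
  by apply/andP; split; lra.
exists u => //; apply/ler_addgt0Pr => e e0.
pose d := e / (2 * (2 * mass + 1)).
have mass1 : 0 < 2 * mass + 1 by rewrite ltr_wpDl// mulr_ge0.
have d0 : 0 < d by rewrite divr_gt0// mulr_gt0.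
(* a net of mesh d / (4 (L + 1)) leaves d / 4 for each of u and us m, and d / 2 for
   their distance on the net *)
have L1 : 0 < 4 * (L + 1) by rewrite mulr_gt0// ltr_wpDl.
have [s sX] := finite_net (divr_gt0 d0 L1).
have [m m0 hm] := near_finite s (d / 2) (Num.truncn (2 / e)) (divr_gt0 d0 (ltr0Sn R 1)).
have [[usl usC] usS] := usP m.
have us_near x : X x -> `|us m x - u x| <= d.
  move=> Xx; have [z [zs Xz] xz] := sX x Xx.
  have h1 := usl _ _ Xx Xz; have h2 := ul _ _ Xx Xz; have h3 := hm z zs.
  have h4 : L * `|x - z| <= d / 4.
    apply: (@le_trans _ _ ((L + 1) * (d / (4 * (L + 1))))).
      by rewrite ler_pM// ?lerDl// ltW.
    rewrite le_eqVlt; apply/orP; left; apply/eqP; field.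
    by rewrite gt_eqF// ltr_wpDl.
  move: (le_trans h1 h4) (le_trans h2 h4) h3.
  rewrite ltr_norml !ler_norml => /andP[a1 a2] /andP[b1 b2] /andP[c1 c2].
  by apply/andP; split; lra.
have busm := lip_bounded usl; have bu := lip_bounded ul.
have conj_near y : Y y -> `|conj_right (us m) y - conj_right u y| <= d.
  move=> Yy; apply: inf_image_dist => //; try exact: minor_right.
  by move=> x Xx; rewrite opprB addrC subrKA distrC us_near.
have dual_near : dual (us m) (conj_right (us m)) <=
    dual u (conj_right u) + (d + d) * mass.
  apply: adm_dual_le; try exact: adm_right.
    by move=> x /us_near; rewrite ler_norml => /andP[_]; rewrite lerBlDl.
  by move=> y /conj_near; rewrite ler_norml => /andP[_]; rewrite lerBlDl.
have dm : (d + d) * mass <= e / 2.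
  have -> : (d + d) * mass = (e / 2) * (2 * mass / (2 * mass + 1)).
    by rewrite /d; field; rewrite gt_eqF.
  rewrite ler_piMr ?divr_ge0 ?(ltW e0)// ler_pdivrMr// mul1r lerDl.
  exact: ler01.
have me : m.+1%:R^-1 <= e / 2.
  have q0 : 0 <= 2 / e by rewrite divr_ge0// ltW.
  rewrite -[leRHS]invrK lef_pV2 ?posrE ?invr_gt0 ?divr_gt0// invf_div.
  have /andP[_ /ltW] := truncn_itv q0.
  by move=> h; apply: le_trans h _; rewrite ler_nat.
have h := le_trans (lerB (lexx (sup values)) me) (ltW usS).
by move: (le_trans h dual_near) dm; lra.
Qed.

Lemma maximizer_exists : exists2 u, lipschitz_on u & forall u' v', admissible u' v' ->
  dual u' v' <= dual u (conj_right u).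
Proof.
have [u [ul _] umax] := maximizer_cls; exists u => // u' v' /adm_cls[u'' u''cls h].
apply: le_trans h (le_trans _ umax); apply: sup_upper_bound; first exact: values_sup.
by exists u''.
Qed.

End maximizer.

(** Replacing u by conj_left (conj_right u) only increases u and keeps the second
function, so the pair stays maximal and becomes conjugate. The infimum that defines
conj_left is attained, by compactness of Y. *)
Lemma conjugate_maximizer : exists uv : (V -> R) * (V -> R),
  let: (u, v) := uv in
  [/\ admissible u v, continuous_on Y v,
      forall x, X x -> exists2 y, Y y & u x + v y = k x y,
      forall y a, Y y -> (forall x, X x -> u x + a <= k x y) -> a <= v y &
      forall u' v', admissible u' v' -> dual u' v' <= dual u v].
Proof.
have [D D0 XD] := X_diam; have [u ul umax] := maximizer_exists D0 XD.
have [_ mv bv uv] := adm_right ul; set v := conj_right u in mv bv uv.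
have [u1l _ _ u1v] := adm_left mv bv.
have uu1 x : X x -> u x <= conj_left v x.
  by move=> Xx; apply: le_inf_image => // y Yy; rewrite lerBrDr uv.
exists (conj_left v, v); split.
- exact: adm_left.
- exact: conj_right_continuous (lip_bounded ul).
- move=> x Xx; have cg : continuous_on Y (fun y => k x y - v y - conj_left v x).
    move=> y Yy e e0; have e20 : 0 < e / 2 by rewrite divr_gt0.
    have [d1 d10 kd] := k_cont Yy e20.
    have [d2 d20 vd] := conj_right_continuous (lip_bounded ul) Yy e20.
    exists (Num.min d1 d2) => [|y' Yy']; first by rewrite lt_min d10.
    rewrite lt_min => /andP[/(kd _ Yy')/(_ _ Xx) h1 /(vd _ Yy') h2].
    move: h1 h2; rewrite -/v !ler_norml => /andP[a1 a2] /andP[b1 b2].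
    by apply/andP; split; lra.
  have [e e0|y [Yy _] h] := continuous_on_closed_inf cY closedT cg.
    have [_ [y Yy <-] h] : exists2 r, ((fun y => k x y - v y) @` Y) r & r < conj_left v x + e.
      apply: inf_adherent => //; split; first exact: image_nonempty.
      by have [b hb] := minor_left bv Xx; exists b => _ [y Yy <-]; exact: hb.
    by exists y => //; rewrite ltrBlDl.
  exists y => //; apply/eqP; rewrite eq_le u1v//=.
  by move: h; rewrite -addrA -opprD subr_le0 addrC.
- move=> y a Yy h; apply: le_inf_image => // x Xx.
  by rewrite lerBrDl (le_trans _ (h x Xx))// lerD2r uu1.
- move=> u' v' /umax h; apply: le_trans h _.
  rewrite -[leRHS]addr0 -(mul0r mass) -(addr0 0).
  apply: adm_dual_le => [||x Xx|y Yy]; try by rewrite addr0 ?uu1.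
    exact: adm_right.
  exact: adm_left.
Qed.

(** The preimage of K under the multivalued map x |-> y of equality in
u x + v y <= k x y. *)
Definition contact (u v : V -> R) (K : set V) :=
  [set x | X x /\ exists2 y, (Y `&` K) y & u x + v y = k x y].

Section mass_comparison.
Variables (u v : V -> R) (K : set V).
Hypothesis uv : admissible u v.
Hypothesis v_cont : continuous_on Y v.
Hypothesis uv_max : forall u' v', admissible u' v' -> dual u' v' <= dual u v.
Hypothesis cK : closed K.

Let near_contact (t : R) :=
  [set x | X x /\ exists2 y, (Y `&` K) y & k x y - v y - u x < t].

Let near_contact_measurable t : measurable (near_contact t : set (borel_rV R n)).
Proof.
have [ul _ _ _] := uv; apply: (relatively_open_measurable mX); first by move=> x [].
move=> x [Xx [y YKy h]]; pose s := t - (k x y - v y - u x).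
have s0 : 0 < s by rewrite subr_gt0.
have L1 : 0 < 2 * L + 1 by rewrite ltr_wpDl// mulr_ge0.
exists (s / (2 * L + 1)) => [|x' Xx' xx']; first exact: divr_gt0.
split => //; exists y => //.
have h1 := ul _ _ Xx Xx'; have h2 := k_lip Xx Xx' YKy.1.
have h3 : 2 * (L * `|x - x'|) < s.
  rewrite mulrA; apply: (@le_lt_trans _ _ ((2 * L + 1) * `|x - x'|)).
    by rewrite ler_wpM2r// lerDl.
  by rewrite mulrC -ltr_pdivlMr.
move: h1 h2 h3; rewrite /s !ler_norml => /andP[a1 a2] /andP[b1 b2]; lra.
Qed.

Let contactE : contact u v K = \bigcap_m near_contact m.+1%:R^-1.
Proof.
have [ul _ _ uvk] := uv.
apply/seteqP; split => [x [Xx [y YKy h]] m _|x h].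
  by split => //; exists y => //; rewrite -h addrK subrr invr_gt0.
have Xx : X x by have [] := h 0%N I.
split => //; have cg : continuous_on Y (fun y => k x y - v y - u x).
  move=> y Yy e e0; have e20 : 0 < e / 2 by rewrite divr_gt0.
  have [d1 d10 kd] := k_cont Yy e20; have [d2 d20 vd] := v_cont Yy e20.
  exists (Num.min d1 d2) => [|y' Yy']; first by rewrite lt_min d10.
  rewrite lt_min => /andP[/(kd _ Yy')/(_ _ Xx) h1 /(vd _ Yy') h2].
  move: h1 h2; rewrite !ler_norml => /andP[a1 a2] /andP[b1 b2].
  by apply/andP; split; lra.
have [e e0|y [Yy Ky] hy] := continuous_on_closed_inf cY cK cg.
  have [_ [y YKy hy]] := h (Num.truncn e^-1) I; exists y => //.
  apply: lt_le_trans hy _; rewrite -[leRHS]invrK lef_pV2 ?posrE ?invr_gt0//.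
  have e1 : 0 <= e^-1 by rewrite invr_ge0 ltW.
  by have /andP[_ /ltW] := truncn_itv e1.
exists y => //; apply/eqP; rewrite eq_le uvk//=.
by move: hy; rewrite -addrA -opprD subr_le0 addrC.
Qed.

Lemma contact_measurable : measurable (contact u v K : set (borel_rV R n)).
Proof. by rewrite contactE; apply: bigcapT_measurable => m; exact: near_contact_measurable. Qed.

Let mYK : measurable (Y `&` K : set (borel_rV R n)).
Proof. by apply: measurableI => //; exact: closed_measurable_rV. Qed.

(** First variation in the direction of the indicator of K: the competitor
(conj_left (v + t 1_K), v + t 1_K) gains t mu(K) and loses at most t on
near_contact t. *)
Let near_contact_mass t : 0 < t -> (mu (Y `&` K) <= nu (near_contact t))%E.
Proof.
move=> t0; have [ul mv bv uvk] := uv.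
pose v' y := v y + t * \1_K y.
have mK : measurable (K : set (borel_rV R n)) by exact: closed_measurable_rV.
have m1 (A Z : set V) : measurable (A : set (borel_rV R n)) ->
    mfun Z (fun y => t * \1_A y).
  by move=> mA; apply: measurable_realfun.measurable_funM.
have b1 (A Z : set V) : bounded_on Z (fun y => t * \1_A y).
  exists t => y _; rewrite indicE normrM (gtr0_norm t0) ler_piMr ?(ltW t0)//.
  by case: (y \in A); rewrite ?normr1 ?normr0.
have bv' : bounded_on Y v'.
  have [b vb] := bv; have [b' vb'] := b1 K Y; exists (b + b') => y Yy.
  by rewrite (le_trans (ler_normD _ _))// lerD ?vb ?vb'.
have mv' : mfun Y v' by apply: measurable_realfun.measurable_funD => //; exact: m1.
have adm' := adm_left mv' bv'; have [ul' _ _ _] := adm'.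
have mA := near_contact_measurable t.
have i1 (m : {measure set (borel_rV R n) -> \bar R}) (A Z : set V) :
    measurable (A : set (borel_rV R n)) -> measurable (Z : set (borel_rV R n)) ->
    (m Z < +oo)%E ->
    \int[m]_(x in Z) (t * \1_A x) = t * fine (m (A `&` Z)).
  move=> m_A mZ Zfin; rewrite RintegralZl//; last first.
    apply: bounded_on_integrable => //.
    by exists 1 => y _; rewrite indicE; case: (y \in A); rewrite ?normr1 ?normr0.
  by rewrite /Rintegral integral_indic.
have u_le x : X x -> u x <= conj_left v' x + t * \1_(near_contact t) x.
  move=> Xx; rewrite -lerBlDr; apply: le_inf_image => // y Yy; rewrite lerBlDr /v'.
  have uvxy := uvk _ _ Xx Yy; rewrite !indicE.
  have [|xA] := boolP (x \in near_contact t); rewrite ?mulr1 ?mulr0.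
    by move=> _; case: (y \in K); rewrite ?mulr1 ?mulr0; move: t0 uvxy; lra.
  have [|_] := boolP (y \in K); rewrite ?mulr1 ?mulr0; last by lra.
  rewrite inE => Ky; have : ~ (k x y - v y - u x < t).
    by move=> h; move: xA; rewrite notin_setE; apply; split => //; exists y.
  by move/negP; rewrite -leNgt; lra.
have h1 : \int[nu]_(x in X) u x <= \int[nu]_(x in X) conj_left v' x +
    t * fine (nu (near_contact t `&` X)).
  rewrite -i1// -RintegralD//; last 2 first.
  - by apply: bounded_on_integrable => //; [exact: lip_measurable|exact: lip_bounded].
  - by apply: bounded_on_integrable => //; exact: m1.
  apply: le_Rintegral => //.
    by apply: bounded_on_integrable => //; [exact: lip_measurable|exact: lip_bounded].
  apply: bounded_on_integrable => //.
    apply: measurable_realfun.measurable_funD; [exact: lip_measurable|exact: m1].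
  have [b vb] := lip_bounded ul'; have [b' vb'] := b1 (near_contact t) X.
  by exists (b + b') => x Xx; rewrite (le_trans (ler_normD _ _))// lerD ?vb ?vb'.
have h2 : \int[mu]_(y in Y) v' y = \int[mu]_(y in Y) v y + t * fine (mu (K `&` Y)).
  rewrite -i1// -RintegralD//; first exact: bounded_on_integrable.
  by apply: bounded_on_integrable => //; exact: m1.
have := uv_max adm'; rewrite /dual h2 => h3.
have h4 : t * fine (mu (K `&` Y)) <= t * fine (nu (near_contact t `&` X)).
  by move: h1 h3; lra.
have AX : near_contact t `<=` X by move=> x [].
rewrite (setIidl AX) (setIC K) in h4.
have muf : mu (Y `&` K) \is a fin_num.
  rewrite ge0_fin_numE//; apply: le_lt_trans mu_fin.
  by apply: le_measure; rewrite ?inE//; exact: subIsetl.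
have nuf : nu (near_contact t) \is a fin_num.
  rewrite ge0_fin_numE//; apply: le_lt_trans nu_fin.
  by apply: le_measure; rewrite ?inE.
by rewrite -(fineK muf) -(fineK nuf) lee_fin; move: h4; rewrite ler_pM2l.
Qed.

(** The sets near_contact t decrease to contact u v K as t decreases to 0. *)
Lemma contact_mass : (mu (Y `&` K) <= nu (contact u v K))%E.
Proof.
have mA m := near_contact_measurable m.+1%:R^-1.
have AX t : near_contact t `<=` X by move=> x [].
have cvgA : nu (near_contact m.+1%:R^-1) @[m --> \oo] --> nu (contact u v K).
  rewrite contactE; apply: (@nonincreasing_cvg_mu _ _ _ nu
    (fun m => near_contact m.+1%:R^-1)) => //.
  - by apply: le_lt_trans nu_fin; apply: le_measure; rewrite ?inE.
  - by apply: bigcapT_measurable => m; exact: mA.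
  - move=> m m' mm'; rewrite subsetEset => x [Xx [y YKy h]]; split => //.
    exists y => //; apply: lt_le_trans h _.
    by rewrite lef_pV2 ?posrE// ler_nat.
rewrite -(cvg_lim _ cvgA)//; apply: lime_ge; first by apply/cvg_ex; eexists; exact: cvgA.
by apply: nearW => m; apply: near_contact_mass; rewrite invr_gt0.
Qed.

End mass_comparison.

(** The properties that refer to the maximization are stated in a form invariant
under (u + c, v - c), which leaves the value of u at x0 free. *)
Theorem kantorovich_potentials (r0 : R) : exists u v : V -> R,
  [/\ lipschitz_on u /\ u x0 = r0,
      forall x y, X x -> Y y -> u x + v y <= k x y,
      forall x, X x -> exists2 y, Y y & u x + v y = k x y,
      forall y a, Y y -> (forall x, X x -> u x + a <= k x y) -> a <= v y &
      forall K, closed K -> measurable (contact u v K : set (borel_rV R n)) /\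
        (mu (Y `&` K) <= nu (contact u v K))%E].
Proof.
have [[u v] [uv vc uv_eq v_max uv_max]] := conjugate_maximizer.
have [ul _ _ uvk] := uv; pose t := r0 - u x0.
have shift x y : (u x + t) + (v y - t) = u x + v y by ring.
exists (fun x => u x + t), (fun y => v y - t); split.
- split; last by rewrite /t addrC subrK.
  by move=> x x' Xx Xx'; rewrite opprD addrACA subrr addr0 ul.
- by move=> x y Xx Yy; rewrite shift uvk.
- by move=> x /uv_eq[y Yy e]; exists y => //; rewrite shift.
- move=> y a Yy h; rewrite lerBrDr; apply: v_max => // x Xx.
  by rewrite addrA addrAC h.
- move=> K cK; have -> : contact (fun x => u x + t) (fun y => v y - t) K = contact u v K.
    by apply/seteqP; split => x [Xx [y Yy e]]; split => //; exists y => //;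
      move: e; rewrite shift.
  by split; [exact: contact_measurable|exact: contact_mass].
Qed.

End kantorovich.

(** * Uniqueness of contacts up to a null set *)

Section exposed_points.
Variables (R : realType) (n : nat) (N : 'rV[R]_n -> R).
Local Notation V := 'rV[R]_n.
Hypotheses (N_norm : is_norm N) (N_C1 : C1_away_from_0 N).
Hypothesis N_strict : contains_no_segment (unit_sphere N).

(** The functional gradient N y has norm 1 and value at least 1 at x and y, so the
segment from x to y lies on the sphere. *)
Lemma strictly_convex_exposed (x y : V) : unit_sphere N x -> unit_sphere N y ->
  1 <= dotp x (gradient N y) -> x = y.
Proof.
move=> Nx Ny xy; apply/eqP; apply: contrapT => /negP x_neq_y.
apply: (N_strict x_neq_y) => t /andP[t0 t1].
have t1' : 0 <= 1 - t by rewrite subr_ge0.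
apply/eqP; rewrite eq_le; apply/andP; split.
  rewrite (le_trans (is_normD N_norm _ _))// !(is_normZ N_norm) !ger0_norm//.
  by rewrite Nx Ny !mulr1 subrK.
apply: le_trans (gradient_le_norm N_norm N_C1 _ (unit_sphere_neq0 N_norm Ny)).
rewrite dotpDl !dotpZl (dotp_gradient_self N_norm N_C1 (unit_sphere_neq0 N_norm Ny)) Ny.
have : (1 - t) * 1 <= (1 - t) * dotp x (gradient N y) by rewrite ler_wpM2l.
lra.
Qed.

End exposed_points.

(** With h = 1 / b = exp v, the function w below is the supremum over m in Y of
h m * (N1 x - x.p2(m)). It is convex and homogeneous on the whole space, and equals
1 / rho at the points of X. It is encoded as the opposite of an infimum. *)
Section double_contacts.
Variables (R : realType) (n : nat) (N1 N2 : 'rV[R]_n -> R) (Y : set 'rV[R]_n).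
Local Notation V := 'rV[R]_n.
Hypotheses (N1_norm : is_norm N1) (N1_C1 : C1_away_from_0 N1).
Hypotheses (N2_norm : is_norm N2) (N2_C1 : C1_away_from_0 N2).
Hypothesis N2_strict : contains_no_segment (unit_sphere N2).
Hypothesis Y_sphere : Y `<=` unit_sphere N2.
Hypothesis Y0 : Y !=set0.
Variables (h : V -> R) (hmax : R).
Hypothesis h_gt0 : forall m, Y m -> 0 < h m.
Hypothesis h_le : forall m, Y m -> h m <= hmax.
Local Notation p1 := (gradient N1).
Local Notation p2 := (gradient N2).

Let Y_neq0 m : Y m -> m != 0.
Proof. by move=> /Y_sphere; exact: unit_sphere_neq0. Qed.

Let g (x m : V) : R := h m * (dotp x (p2 m) - N1 x).
Let w (x : V) : R := - inf (g x @` Y).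

Let dotp_p2_bound x m : Y m -> `|dotp x (p2 m)| <= N2 x.
Proof.
move=> Ym; rewrite ler_norml gradient_le_norm ?Y_neq0// andbT lerNl -dotpNl.
by rewrite -(is_normN N2_norm x) gradient_le_norm ?Y_neq0.
Qed.

Let hmax_ge0 : 0 <= hmax.
Proof. by have [m Ym] := Y0; rewrite (le_trans _ (h_le Ym))// ltW// h_gt0. Qed.

Let g_minorized x : minorized Y (g x).
Proof.
exists (- (hmax * (N2 x + N1 x))) => m Ym.
have := dotp_p2_bound x Ym; rewrite ler_norml => /andP[h1 h2].
apply: (@le_trans _ _ (h m * - (N2 x + N1 x))).
  by rewrite mulrN lerN2 ler_wpM2r ?h_le// addr_ge0 ?is_norm_ge0.
by rewrite ler_wpM2l ?(ltW (h_gt0 Ym))// opprD lerD.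
Qed.

Let w_lip : exists L, forall x y, `|w x - w y| <= L * `|x - y|.
Proof.
have [C1 _ N1C] := is_norm_bounded N1_norm; have [C2 _ N2C] := is_norm_bounded N2_norm.
exists (hmax * (C2 + C1)) => x y; rewrite -opprD normrN -/(inf _ - inf _).
apply: inf_image_dist => // m Ym; rewrite /g -mulrBr normrM gtr0_norm ?h_gt0//.
rewrite -mulrA ler_pM ?h_le ?(ltW (h_gt0 Ym))//.
have -> : dotp x (p2 m) - N1 x - (dotp y (p2 m) - N1 y) =
  dotp (x - y) (p2 m) - (N1 x - N1 y) by rewrite dotpBl; ring.
rewrite (le_trans (ler_normB _ _))// mulrDl lerD//.
  exact: le_trans (dotp_p2_bound _ Ym) (N2C _).
exact: le_trans (is_norm_distl N1_norm _ _) (N1C _).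
Qed.

Let w_convex x z : 2 * w x <= w (x + z) + w (x - z).
Proof.
have : (inf (g (x + z) @` Y) + inf (g (x - z) @` Y)) / 2 <= inf (g x @` Y).
  apply: le_inf_image => // m Ym; rewrite ler_pdivrMr//.
  have h1 := inf_image_le (g_minorized (x + z)) Ym.
  have h2 := inf_image_le (g_minorized (x - z)) Ym.
  apply: le_trans (lerD h1 h2) _; rewrite /g -mulrDr -mulrA ler_wpM2l ?(ltW (h_gt0 Ym))//.
  rewrite dotpDl dotpBl.
  have : N1 (2 *: x) <= N1 (x + z) + N1 (x - z).
    have -> : 2 *: x = (x + z) + (x - z) by rewrite addrACA subrr addr0 scaler_nat mulr2n.
    exact: is_normD.
  by rewrite (is_normZ N1_norm) ger0_norm//; lra.
by rewrite /w; lra.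
Qed.

Let w_homog t x : 0 < t -> w (t *: x) = t * w x.
Proof.
have gZ s y m : 0 < s -> g (s *: y) m = s * g y m.
  by move=> s0; rewrite /g dotpZl (is_normZ N1_norm) gtr0_norm//; ring.
have half s y : 0 < s -> s * inf (g y @` Y) <= inf (g (s *: y) @` Y).
  move=> s0; apply: le_inf_image => // m Ym; rewrite gZ// ler_pM2l//.
  exact: inf_image_le.
move=> t0; rewrite /w mulrN; congr (- _); apply/eqP; rewrite eq_le half// andbT.
have := half t^-1 (t *: x); rewrite invr_gt0 => /(_ t0).
by rewrite scalerA mulVf ?gt_eqF// scale1r ler_pdivrMl.
Qed.

(** The point m attains the supremum defining w at a point x with N1 x = 1. *)
Let active x m := Y m /\ forall m', Y m' ->
  h m' * (1 - dotp x (p2 m')) <= h m * (1 - dotp x (p2 m)).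

Let support x m : V := h m *: (p1 x - p2 m).

Let support_touches x m : N1 x = 1 -> active x m -> touches w (support x m) x.
Proof.
move=> Nx [Ym mmax]; have x0 : x != 0 by exact: (@unit_sphere_neq0 _ _ N1).
split => [z|].
  rewrite dotpZl dotpBl (dotpC (p1 x)) (dotpC (p2 m)).
  apply: (@le_trans _ _ (- g z m)); last by rewrite lerN2 inf_image_le.
  rewrite /g -mulrN opprB ler_wpM2l ?(ltW (h_gt0 Ym))// lerB//.
  exact: gradient_le_norm.
rewrite dotpZl dotpBl (dotpC (p1 x)) (dotpC (p2 m)) dotp_gradient_self// Nx.
have -> : h m * (1 - dotp x (p2 m)) = - g x m by rewrite /g Nx; ring.
congr (- _); apply/eqP; rewrite eq_le inf_image_le// andbT.
apply: le_inf_image => // m' Ym'.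
by rewrite /g Nx -lerN2 -!mulrN !opprB mmax.
Qed.

(** Assume h m <= h m'. Pairing the equality of the supports with m gives
h m * (m.p1(x) - 1) = h m' * (m.p1(x) - m.p2(m')), because m.p2(m) = 1; as m.p1(x) >= 1,
it follows that m.p2(m') >= 1, and strict convexity identifies m and m'. *)
Let support_inj x m m' : N1 x = 1 -> (forall m, Y m -> 1 <= dotp m (p1 x)) ->
  Y m -> Y m' -> support x m = support x m' -> m = m'.
Proof.
move=> Nx Yx; wlog hh : m m' / h m <= h m'.
  move=> th Ym Ym' e; have [hle|/ltW hle] := leP (h m) (h m'); first exact: th.
  by apply/esym/th.
move=> Ym Ym' e; apply: (strictly_convex_exposed N2_norm N2_C1 N2_strict);
  [exact: Y_sphere|exact: Y_sphere|].
have hm := h_gt0 Ym; have hm' := h_gt0 Ym'.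
have : dotp m (support x m) = dotp m (support x m') by rewrite e.
rewrite !dotpZr !dotpBr (dotp_gradient_self N2_norm N2_C1 (Y_neq0 Ym)) (Y_sphere Ym).
have m1 := Yx _ Ym => e1.
have : h m * (dotp m (p1 x) - 1) <= h m' * (dotp m (p1 x) - 1).
  by rewrite ler_wpM2r// subr_ge0.
by rewrite e1 ler_pM2l// lerD2l lerN2.
Qed.

Lemma double_contact_null (X : set V) : X `<=` unit_sphere N1 ->
    (forall x m, X x -> Y m -> 1 <= dotp m (p1 x)) ->
  hausdorff_outer n.-1 [set x | X x /\ exists m m',
    [/\ m != m', active x m & active x m']] = 0%E.
Proof.
move=> X_sphere XY; have [L wL] := w_lip.
apply/eqP; rewrite eq_le hausdorff_outer_ge0 andbT.
rewrite -(sphere_kinks_null N1_norm wL w_convex w_homog).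
apply: le_hausdorff_outer => x [Xx [m [m' [mm' am am']]]].
have Nx := X_sphere _ Xx; split => //.
exists (support x m), (support x m'); split; try exact: support_touches.
apply: contra_neq mm'; apply: support_inj => //; first by move=> m'' /XY; apply.
  by case: am.
by case: am'.
Qed.

End double_contacts.

(** * From bounds on closed sets to the refractor measure *)

Section integral_measure.
Local Open Scope ereal_scope.
Context d (T : measurableType d) (R : realType) (m : {measure set T -> \bar R}).
Variable g : T -> \bar R.
Hypothesis g_ge0 : forall x, 0 <= g x.
Hypothesis g_meas : measurable_fun [set: T] g.

(** The proofs are arguments so that the measure structure can be found from the
term alone. *)
Definition integral_measure of (forall x, 0 <= g x) & measurable_fun [set: T] g :=
  fun E : set T => \int[m]_(x in E) g x.

Local Notation gm := (integral_measure g_ge0 g_meas).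

Let integral_measure0 : gm set0 = 0.
Proof. exact: integral_set0. Qed.

Let integral_measure_ge0 E : 0 <= gm E.
Proof. by apply: integral_ge0 => x _; exact: g_ge0. Qed.

Let integral_measure_sigma_additive : semi_sigma_additive gm.
Proof.
move=> F mF tF mUF; rewrite /integral_measure ge0_integral_bigcup//.
  by apply: is_cvg_ereal_nneg_natsum => k _; exact: integral_measure_ge0.
by move: g_meas; apply: measurable_funS.
Qed.

HB.instance Definition _ := isMeasure.Build _ _ _ gm
  integral_measure0 integral_measure_ge0 integral_measure_sigma_additive.

End integral_measure.

(** The absolute value of f, cut off outside X, is a nonnegative density everywhere,
while f itself is only positive almost everywhere on X. *)
Lemma density_measure_exists d (T : measurableType d) (R : realType)
    (m : {measure set T -> \bar R}) (X : set T) (f : T -> R) :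
    measurable X -> m.-integrable X (EFin \o f) ->
    {ae m, forall x, X x -> 0 < f x} ->
  exists2 nu : {measure set T -> \bar R},
    forall A, measurable A -> A `<=` X -> (\int[m]_(x in A) (f x)%:E)%E = nu A &
    forall A, measurable A -> m A = 0%E -> nu A = 0%E.
Proof.
move=> mX f_L1 f_gt0.
have mf : measurable_fun X f by apply/measurable_EFinP; exact: measurable_int f_L1.
pose g : T -> \bar R := (EFin \o (fun x => `|f x|)) \_ X.
have g_ge0 x : (0 <= g x)%E.
  by rewrite /g patchE; case: ifP => // _; rewrite lee_fin.
have g_meas : measurable_fun [set: T] g.
  apply/(measurable_restrictT _ mX).1.
  by apply/measurable_EFinP; exact: measurableT_comp.
exists (integral_measure m g_ge0 g_meas) => [A mA AX|A mA mA0].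
  apply: ae_eq_integral => //.
  - by apply/measurable_EFinP; exact: measurable_funS mf.
  - exact: measurable_funS g_meas.
  - move: f_gt0; apply: filterS => x fx Ax.
    rewrite /g patchE mem_set; last exact: AX.
    by rewrite /= gtr0_norm//; apply: fx; exact: AX.
by apply: null_set_integral => //; exact: measurable_funS g_meas.
Qed.

Section borel_restriction.
Variables (R : realType) (n d : nat).
Variable m : {measure set (hausdorff_type R n d) -> \bar R}.

Definition borel_restriction : set (borel_rV R n) -> \bar R := m.

Let borel_restriction0 : borel_restriction set0 = 0%E.
Proof. exact: measure0. Qed.

Let borel_restriction_ge0 E : (0 <= borel_restriction E)%E.
Proof. exact: measure_ge0. Qed.

Let borel_restriction_sigma_additive : semi_sigma_additive borel_restriction.
Proof.
move=> F mF tF mUF; apply: (@measure_semi_sigma_additive _ _ _ m) => //.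
  by move=> k; exact: borel_caratheodory.
exact: borel_caratheodory.
Qed.

HB.instance Definition _ := isMeasure.Build _ _ _ borel_restriction
  borel_restriction0 borel_restriction_ge0 borel_restriction_sigma_additive.

End borel_restriction.

Lemma hausdorff_null_measurable (R : realType) (n d : nat) (A : set 'rV[R]_n) :
  hausdorff_outer d A = 0%E -> measurable (A : set (hausdorff_type R n d)).
Proof.
move=> A0; apply: le_caratheodory_measurable => Z /=.
have -> : hausdorff_outer_measure R n d (Z `&` A) = 0%E.
  apply/eqP; rewrite eq_le outer_measure_ge0 andbT.
  by rewrite -[leRHS]A0; apply: le_hausdorff_outer => x [].
by rewrite add0e; apply: le_hausdorff_outer => x [].
Qed.

Section multivalued_transport.
Variables (R : realType) (n d : nat).
Local Notation V := 'rV[R]_n.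
Variables (X Y : set V) (rel : V -> V -> Prop).
Variables (nu : {measure set (hausdorff_type R n d) -> \bar R}).
Variables (mu : {measure set (borel_rV R n) -> \bar R}).

Definition rel_preimage (E : set V) := [set x | X x /\ exists2 y, (Y `&` E) y & rel x y].

Hypothesis mX : measurable (X : set (hausdorff_type R n d)).
Hypothesis mY : measurable (Y : set (borel_rV R n)).
Hypothesis nu_ac : forall A : set (hausdorff_type R n d),
  hausdorff_outer d A = 0%E -> nu A = 0%E.
Hypothesis rel_total : forall x, X x -> exists2 y, Y y & rel x y.
Hypothesis rel_unique : hausdorff_outer d
  [set x | X x /\ exists y y', [/\ y != y', Y y /\ rel x y & Y y' /\ rel x y']] = 0%E.
Hypothesis rel_closed : forall K, closed K ->
  measurable (rel_preimage K : set (hausdorff_type R n d)) /\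
  (mu (Y `&` K) <= nu (rel_preimage K))%E.
Hypothesis mu_fin : (mu Y < +oo)%E.
Hypothesis mass_eq : nu X = mu Y.
Hypothesis mu_inner : forall E : set (borel_rV R n), measurable E -> E `<=` Y ->
  mu E = ereal_sup [set mu K | K in [set K : set V | compact K /\ K `<=` E]].

Let overlap_null (E F : set V) : E `&` F = set0 ->
  hausdorff_outer d (rel_preimage E `&` rel_preimage F) = 0%E.
Proof.
move=> EF; apply/eqP; rewrite eq_le hausdorff_outer_ge0 andbT -[leRHS]rel_unique.
apply: le_hausdorff_outer => x [[Xx [y [Yy Ey] xy]] [_ [z [Yz Fz] xz]]].
split => //; exists y, z; split => //; apply/eqP => yz.
by have : (E `&` F) y by [split => //; rewrite yz]; rewrite EF.
Qed.

Let preimageC E : rel_preimage (~` E) =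
  (X `\` rel_preimage E) `|` (rel_preimage E `&` rel_preimage (~` E)).
Proof.
apply/seteqP; split => x.
  move=> xE; have [h|h] := pselect (rel_preimage E x); first by right.
  by left; split => //; case: xE.
move=> [[Xx h]|[]//]; split => //; have [y Yy xy] := rel_total Xx.
by exists y => //; split => // Ey; apply: h; split => //; exists y.
Qed.

(** The sets with measurable preimage form a sigma-algebra: the preimages of E and
of its complement cover X and overlap in a null set, which is measurable by
completeness. *)
Lemma rel_preimage_measurable (E : set (borel_rV R n)) : measurable E ->
  measurable (rel_preimage E : set (hausdorff_type R n d)).
Proof.
have mC E' : measurable (rel_preimage E' : set (hausdorff_type R n d)) ->
    measurable (rel_preimage (~` E') : set (hausdorff_type R n d)).
  move=> mE; rewrite preimageC; apply: measurableU; first exact: measurableD.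
  by apply: hausdorff_null_measurable; apply: overlap_null; rewrite setICr.
pose P := [set E' : set V | measurable (rel_preimage E' : set (hausdorff_type R n d))].
apply: (@smallest_sub _ (sigma_algebra setT) open P); last first.
  move=> G oG; rewrite /P/= -(setCK G); apply: mC.
  by have [] := rel_closed (open_closedC oG).
split.
- rewrite /P /= (_ : rel_preimage set0 = set0)//.
  by apply/seteqP; split => x // [_ [y []]].
- by move=> E'; rewrite setTD; exact: mC.
- move=> F mF; rewrite /P /= (_ : rel_preimage _ = \bigcup_k rel_preimage (F k)).
    exact: bigcupT_measurable.
  apply/seteqP; split => x.
    by move=> [Xx [y [Yy [k _ Fy]] xy]]; exists k => //; split => //; exists y.
  by move=> [k _ [Xx [y [Yy Fy] xy]]]; split => //; exists y => //; split => //; exists k.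
Qed.

Let mu_le (E : set (borel_rV R n)) : measurable E -> E `<=` Y ->
  (mu E <= nu (rel_preimage E))%E.
Proof.
move=> mE EY; rewrite mu_inner//; apply: ge_ereal_sup => _ [K [cK KE] <-].
have clK : closed K by exact: (compact_closed (@norm_hausdorff _ _)).
have [mK] := rel_closed clK.
rewrite setIidr; last exact: subset_trans EY.
move/le_trans; apply; apply: le_measure; rewrite ?inE//.
  exact: rel_preimage_measurable.
by move=> x [Xx [y [Yy Ky] xy]]; split => //; exists y => //; split => //; exact: KE.
Qed.

(** The bound mu E <= nu (rel_preimage E) holds for E and for Y minus E; as the two
preimages are disjoint up to a null set, neither inequality can be strict. *)
Lemma rel_preimage_measure (E : set (borel_rV R n)) : measurable E -> E `<=` Y ->
  nu (rel_preimage E) = mu E.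
Proof.
move=> mE EY; apply/eqP; rewrite eq_le mu_le// andbT.
have mYE : measurable (Y `\` E : set (borel_rV R n)) by exact: measurableD.
have mpE := rel_preimage_measurable mE; have mpYE := rel_preimage_measurable mYE.
have muYE : mu (Y `\` E) \is a fin_num.
  rewrite ge0_fin_numE//; apply: le_lt_trans mu_fin.
  by apply: le_measure; rewrite ?inE//; exact: subDsetl.
have muY : mu Y = (mu E + mu (Y `\` E))%E.
  rewrite -measureU//; last by rewrite setDIK.
  by rewrite setDUK.
have XE : X = rel_preimage E `|` (rel_preimage (Y `\` E) `\` rel_preimage E).
  apply/seteqP; split => [x Xx|x [[]//|[[]//]]].
  have [y Yy xy] := rel_total Xx; have [xE|xE] := pselect (rel_preimage E x).
    by left.
  right; split => //; split => //; exists y => //; split => //; split => // Ey.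
  by apply: xE; split => //; exists y.
have nuX : nu X = (nu (rel_preimage E) + nu (rel_preimage (Y `\` E)))%E.
  rewrite [in LHS]XE measureU//; last by rewrite setDIK.
    congr (_ + _)%E; rewrite [RHS](measureDI nu mpYE mpE).
    rewrite [X in (_ + X)%E](nu_ac _) ?adde0//.
    by apply: overlap_null; rewrite setDE -setIA setICl setI0.
  exact: measurableD.
rewrite -(leeD2rE _ _ muYE) -muY -mass_eq nuX leeD2l//.
by apply: mu_le => // x [].
Qed.

End multivalued_transport.

(** * The refractor cost *)

Lemma ln_dist_le (R : realType) (delta a b : R) : 0 < delta -> delta <= a -> delta <= b ->
  `|ln a - ln b| <= `|a - b| / delta.
Proof.
move=> d0.
have one (s t : R) : delta <= s -> delta <= t -> ln s - ln t <= `|s - t| / delta.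
  move=> ds dt; have s0 := lt_le_trans d0 ds; have t0 := lt_le_trans d0 dt.
  rewrite -ln_div ?posrE//.
  have -> : s / t = 1 + (s / t - 1) by ring.
  apply: le_trans (le_ln1Dx _) _; first by rewrite ltrBrDr addrC subrr divr_gt0.
  have -> : s / t - 1 = (s - t) / t by field; rewrite gt_eqF.
  apply: (@le_trans _ _ (`|s - t| / t)).
    by rewrite ler_wpM2r ?invr_ge0 ?(ltW t0)// ler_norm.
  by rewrite ler_wpM2l// lef_pV2.
move=> da db; rewrite ler_norml one// andbT lerNl opprB distrC one//.
Qed.

Section refractor_cost.
Variables (R : realType) (n : nat) (N2 : 'rV[R]_n -> R).
Local Notation V := 'rV[R]_n.
Hypotheses (N2_norm : is_norm N2) (N2_C1 : C1_away_from_0 N2).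
Variables (X Y : set V).
Hypothesis (Y_sphere : Y `<=` unit_sphere N2).
Variable r : R.
Hypothesis r_lt1 : r < 1.
Hypothesis N2_le : forall x, X x -> N2 x <= r.

Definition refractor_cost (x m : V) : R := - ln (1 - dotp x (gradient N2 m)).

Let Y_neq0 m : Y m -> m != 0.
Proof. by move=> /Y_sphere; exact: unit_sphere_neq0. Qed.

Let r1 : 0 < 1 - r. Proof. by rewrite subr_gt0. Qed.

Let dotp_le x m : Y m -> dotp x (gradient N2 m) <= N2 x.
Proof. by move=> Ym; apply: gradient_le_norm => //; exact: Y_neq0. Qed.

Lemma cost_arg_ge x m : X x -> Y m -> 1 - r <= 1 - dotp x (gradient N2 m).
Proof. by move=> Xx Ym; rewrite lerD2l lerN2 (le_trans (dotp_le x Ym))// N2_le. Qed.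

Lemma cost_arg_gt0 x m : X x -> Y m -> 0 < 1 - dotp x (gradient N2 m).
Proof. by move=> Xx Ym; exact: lt_le_trans (cost_arg_ge Xx Ym). Qed.

Lemma refractor_cost_bounded x m : X x -> Y m -> `|refractor_cost x m| <= 1 / (1 - r).
Proof.
move=> Xx Ym; rewrite /refractor_cost normrN.
have := ln_dist_le r1 (cost_arg_ge Xx Ym) (_ : 1 - r <= 1).
have r0 : 0 <= r by rewrite (le_trans (is_norm_ge0 N2_norm x))// N2_le.
rewrite ln1 subr0 gerBl => /(_ r0); move/le_trans; apply.
rewrite ler_wpM2r ?invr_ge0 ?(ltW r1)// addrAC subrr add0r normrN.
rewrite ler_norml (le_trans (dotp_le x Ym) (le_trans (N2_le Xx) (ltW r_lt1))) andbT.
rewrite lerNl -dotpNl (le_trans (dotp_le _ Ym))// is_normN//.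
exact: le_trans (N2_le Xx) (ltW r_lt1).
Qed.

Lemma refractor_cost_lipschitz : exists2 L, 0 <= L & forall x x' m, X x -> X x' -> Y m ->
  `|refractor_cost x m - refractor_cost x' m| <= L * `|x - x'|.
Proof.
have [C C0 NC] := is_norm_bounded N2_norm.
exists (C / (1 - r)) => [|x x' m Xx Xx' Ym]; first by rewrite divr_ge0 ?ltW.
rewrite -opprD normrN (le_trans (ln_dist_le r1 (cost_arg_ge Xx Ym) (cost_arg_ge Xx' Ym)))//.
rewrite mulrAC ler_wpM2r ?invr_ge0 ?(ltW r1)//.
have -> : 1 - dotp x (gradient N2 m) - (1 - dotp x' (gradient N2 m)) =
  dotp (x' - x) (gradient N2 m) by rewrite dotpBl; ring.
rewrite ler_norml; apply/andP; split.
  rewrite lerNl -dotpNl opprB (le_trans (dotp_le _ Ym))//.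
by rewrite (le_trans (dotp_le _ Ym))// (le_trans (NC _))// distrC.
Qed.

(** The modulus in m is that of the gradient of N2, which is continuous but need not
be Lipschitz; this is why the potential u, not v, carries the compactness. *)
Lemma refractor_cost_equicontinuous m : compact X -> Y m -> forall e : R, 0 < e ->
  exists2 d : R, 0 < d & forall m', Y m' -> `|m - m'| < d ->
    forall x, X x -> `|refractor_cost x m - refractor_cost x m'| <= e.
Proof.
move=> cX Ym e e0; have [M [_ XM]] := compact_bounded cX.
have [XD0 XD] : 0 < `|M| + 1 /\ forall x, X x -> `|x| <= `|M| + 1.
  split; first by rewrite ltr_wpDl.
  by move=> x Xx; apply: XM => //; rewrite ltr_pwDr// ler_norm.
set D := `|M| + 1 in XD0 XD.
pose e' := e * (1 - r) / (n%:R * D + 1).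
have nD : 0 < n%:R * D + 1 by rewrite ltr_wpDl// mulr_ge0// ltW.
have e'0 : 0 < e' by rewrite divr_gt0// mulr_gt0.
have [_ gm] := N2_C1 (Y_neq0 Ym).
have /nbhs_ballP[d /= d0 dB] := gm _ (nbhsx_ballx (gradient N2 m) e' e'0).
exists d => // m' Ym' mm' x Xx.
have := dB m'; rewrite -ball_normE => /(_ mm') /= gmm'.
rewrite -opprD normrN (le_trans (ln_dist_le r1 (cost_arg_ge Xx Ym) (cost_arg_ge Xx Ym')))//.
rewrite ler_pdivrMr//.
have -> : 1 - dotp x (gradient N2 m) - (1 - dotp x (gradient N2 m')) =
  - dotp x (gradient N2 m - gradient N2 m') by rewrite dotpBr; ring.
rewrite normrN (le_trans (dotp_le_norm _ _))//.
apply: (@le_trans _ _ ((n%:R * D + 1) * e')).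
  rewrite ler_pM ?(ltW gmm')// ?mulr_ge0//.
  by rewrite ler_wpDr// ler_wpM2l// XD.
by rewrite /e' mulrC divfK// gt_eqF.
Qed.

(** With rho = exp u, a supporting surface with parameter b touches at x exactly when
v m = - ln b and equality holds at x: the largest admissible - ln b is v m. *)
Lemma refractor_map_contact (u v : V -> R) :
  (forall x m, X x -> Y m -> u x + v m <= refractor_cost x m) ->
  (forall m a, Y m -> (forall x, X x -> u x + a <= refractor_cost x m) -> a <= v m) ->
  forall x m, X x ->
    refractor_map N2 X Y (fun z => expR (u z)) x m <->
    Y m /\ u x + v m = refractor_cost x m.
Proof.
move=> uv vmax x m Xx.
have costE z b : X z -> Y m -> 0 < b ->
    expR (refractor_cost z m + ln b) = b / (1 - dotp z (gradient N2 m)).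
  move=> Xz Ym b0; rewrite expRD expRN !lnK ?posrE// ?cost_arg_gt0//.
  by rewrite mulrC.
split => [[Ym [b b0 [ub ux]]]|[Ym uxm]]; last first.
  split => //; exists (expR (- v m)); first exact: expR_gt0.
  split => [z Xz|]; rewrite -costE ?expR_gt0// expRK.
    by rewrite ler_expR lerBrDr uv.
  by rewrite -uxm addrK.
split => //; apply/eqP; rewrite eq_le uv//=.
have uxE : u x = refractor_cost x m + ln b.
  by apply: expR_inj; rewrite costE.
have : - ln b <= v m.
  apply: vmax => // z Xz; rewrite lerBlDr -ler_expR costE//; exact: ub.
by rewrite uxE; lra.
Qed.

(** At a contact the product exp (v m) (1 - x.p2(m)) equals exp (- u x), which bounds
it for every other m. *)
Lemma contact_active (u v : V -> R) :
  (forall x m, X x -> Y m -> u x + v m <= refractor_cost x m) ->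
  forall x m, X x -> Y m -> u x + v m = refractor_cost x m ->
  forall m', Y m' -> expR (v m') * (1 - dotp x (gradient N2 m')) <=
    expR (v m) * (1 - dotp x (gradient N2 m)).
Proof.
move=> uv x m Xx Ym uxm.
have prodE m' : Y m' -> expR (v m') * (1 - dotp x (gradient N2 m')) =
    expR (v m' - refractor_cost x m').
  by move=> Ym'; rewrite opprK expRD lnK// posrE cost_arg_gt0.
move=> m' Ym'; rewrite (prodE _ Ym') (prodE _ Ym) ler_expR -uxm.
by rewrite opprD addrCA subrr addr0 lerBlDr -lerBlDl opprK addrC uv.
Qed.

End refractor_cost.

Section closed_domains.
Variables (R : realType) (n : nat) (N : 'rV[R]_n -> R) (Om : set 'rV[R]_n).
Hypothesis N_norm : is_norm N.
Hypothesis Om_domain : closed_domain (unit_sphere N) Om.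

Lemma closed_domain_sphere : Om `<=` unit_sphere N.
Proof. by have [U [_ _ _ ->]] := Om_domain; move=> x []. Qed.

Lemma closed_domain_compact : compact Om.
Proof.
have [U [_ _ _ ->]] := Om_domain; rewrite setIC.
by apply: compact_closedI; [exact: compact_unit_sphere|exact: closed_closure].
Qed.

Lemma closed_domain_nonempty : Om !=set0.
Proof.
have [U [[x Ux] _ [W _ UE] ->]] := Om_domain; exists x; split.
  exact: subset_closure.
by move: Ux; rewrite UE => -[].
Qed.

End closed_domains.

Lemma ereal_sup_lt1 (R : realType) (T : Type) (A : set T) (F : T -> R) :
  (ereal_sup [set (F x)%:E | x in A] < 1)%E ->
  exists2 r : R, r < 1 & forall x, A x -> F x <= r.
Proof.
move=> sup1; have ub x : A x -> ((F x)%:E <= ereal_sup [set (F x)%:E | x in A])%E.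
  by move=> Ax; apply: ereal_sup_ubound; exists x.
move: sup1 ub; case: (ereal_sup _) => [r|//|_ ub].
  by rewrite lte_fin => r1 ub; exists r.
by exists 0 => // x /ub; rewrite leeNy_eq.
Qed.


Theorem theorem5p7 (R : realType) (n : nat) (n_ge2 : (2 <= n)%N)
  (N1 N2 : 'rV[R]_n -> R)
  (N1_norm : is_norm N1) (N2_norm : is_norm N2)
  (N1_C1 : C1_away_from_0 N1) (N2_C1 : C1_away_from_0 N2)
  (N1_strict : contains_no_segment (unit_sphere N1))
  (N2_strict : contains_no_segment (unit_sphere N2))
  (kappa_lt1 : (ereal_sup [set (N2 x)%:E | x in unit_sphere N1] < 1)%E)
  (Om1 Om2 : set 'rV[R]_n)
  (Om1_domain : closed_domain (unit_sphere N1) Om1)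
  (Om2_domain : closed_domain (unit_sphere N2) Om2)
  (Om1_boundary :
    surface_measure R n (rel_boundary (unit_sphere N1) Om1) = 0%E)
  (Om12_inf : (1 <= ereal_inf
    [set (dotp m (gradient N1 x))%:E | x in Om1 & m in Om2])%E)
  (f : surface_type R n -> R)
  (f_L1 : (surface_measure R n).-integrable Om1 (EFin \o f))
  (f_gt0 : {ae surface_measure R n, forall x, Om1 x -> 0 < f x})
  (mu : {measure set (borel_rV R n) -> \bar R})
  (mu_radon : radon_in Om2 mu)
  (mass_balance : (\int[surface_measure R n]_(x in Om1) (f x)%:E = mu Om2)%E)
  (x0 : 'rV[R]_n) (Om1_x0 : Om1 x0) (R0 : R) (R0_gt0 : 0 < R0) :
  exists rho : 'rV[R]_n -> R,
    weak_solution N2 Om1 Om2 f mu rho /\ rho x0 = R0.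
Proof.
have [r r1 N2r] := ereal_sup_lt1 kappa_lt1.
have S1 := closed_domain_sphere Om1_domain; have S2 := closed_domain_sphere Om2_domain.
have cOm1 := closed_domain_compact N1_norm Om1_domain.
have cOm2 := closed_domain_compact N2_norm Om2_domain.
have Om20 := closed_domain_nonempty Om2_domain.
have N2le x : Om1 x -> N2 x <= r by move=> /S1; exact: N2r.
pose k := refractor_cost N2.
have k_bounded : forall x m, Om1 x -> Om2 m -> `|k x m| <= 1 / (1 - r).
  by move=> x m; exact: refractor_cost_bounded.
have [L L0 k_lip] := refractor_cost_lipschitz N2_norm N2_C1 S2 r1 N2le.
have k_cont := fun m =>
  refractor_cost_equicontinuous N2_norm N2_C1 S2 r1 N2le cOm1 (m := m).
have mOm1 : measurable (Om1 : set (borel_rV R n)) by exact: compact_measurable_rV.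
have mOm2 : measurable (Om2 : set (borel_rV R n)) by exact: compact_measurable_rV.
have mOm1' : measurable (Om1 : set (surface_type R n)) by exact: borel_caratheodory.
have [nuhat nuhatE nuhat_ac] := density_measure_exists mOm1' f_L1 f_gt0.
pose nu : {measure set (borel_rV R n) -> \bar R} := borel_restriction nuhat.
have mass : nuhat Om1 = mu Om2 by rewrite -nuhatE.
have nu_fin : (nuhat Om1 < +oo)%E.
  rewrite -nuhatE//; have := integrable_fin_num mOm1' f_L1.
  by rewrite fin_numE ltey => /andP[].
have mu_fin : (mu Om2 < +oo)%E by rewrite -mass.
have [u [v [[ul ux0] uv uv_eq v_max uv_mass]]] := kantorovich_potentials cOm1 cOm2
  Om1_x0 Om20 L0 k_bounded k_lip k_cont (nu_fin : (nu Om1 < +oo)%E)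
  (mass : nu Om1 = mu Om2) (ln R0).
(* the pair comes from maximization with u x0 = ln R0, so rho x0 = R0 *)
pose rho z := expR (u z); pose rel x m := u x + v m = k x m.
have mapE x m : Om1 x -> refractor_map N2 Om1 Om2 rho x m <->
    Om2 m /\ rel x m.
  by move=> Om1x; apply: (refractor_map_contact N2_norm N2_C1 S2 r1 N2le).
have preimE E : refractor_preimage N2 Om1 Om2 rho E =
    rel_preimage Om1 Om2 rel E.
  apply/seteqP; split => x [Om1x].
    by move=> [m [/(mapE _ _ Om1x)[Om2m xm] Em]]; split => //; exists m.
  by move=> [m [Om2m Em] xm]; split => //; exists m; split => //; apply/mapE.
have unique : hausdorff_outer n.-1 [set x | Om1 x /\ exists m m',
    [/\ m != m', Om2 m /\ rel x m & Om2 m' /\ rel x m']] = 0%E.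
  pose hmax := expR (1 / (1 - r) - u x0).
  have h_le m : Om2 m -> expR (v m) <= hmax.
    move=> Om2m; rewrite ler_expR lerBrDl (le_trans (uv _ _ Om1_x0 Om2m))//.
    by rewrite (le_trans (ler_norm _))// k_bounded.
  have Om12 x m : Om1 x -> Om2 m -> 1 <= dotp m (gradient N1 x).
    move=> Om1x Om2m; rewrite -lee_fin (le_trans Om12_inf)//.
    by apply: ereal_inf_lbound; exists x => //; exists m.
  have null := double_contact_null N1_norm N1_C1 N2_norm N2_C1 N2_strict S2 Om20
    (fun m _ => expR_gt0 (v m)) h_le S1 Om12.
  apply/eqP; rewrite eq_le hausdorff_outer_ge0 andbT -[leRHS]null.
  apply: le_hausdorff_outer => x [Om1x [m [m' [mm' [Ym xm] [Ym' xm']]]]].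
  split => //; exists m, m'; split => //; split => //.
    exact: (contact_active N2_norm N2_C1 S2 r1 N2le uv).
  exact: (contact_active N2_norm N2_C1 S2 r1 N2le uv).
have nu_ac (A : set (surface_type R n)) : hausdorff_outer n.-1 A = 0%E -> nuhat A = 0%E.
  by move=> A0; apply: nuhat_ac => //; exact: hausdorff_null_measurable.
have rel_closed K : closed K ->
    measurable (rel_preimage Om1 Om2 rel K : set (surface_type R n)) /\
    (mu (Om2 `&` K) <= nuhat (rel_preimage Om1 Om2 rel K))%E.
  by move=> /uv_mass[mK leK]; split => //; exact: borel_caratheodory.
have rho_cont : {within Om1, continuous rho}.
  apply/subspace_continuousP => x Om1x.
  apply: (@cvg_comp _ _ _ u expR _ (nbhs (u x))); last exact: continuous_expR.
  move=> A /nbhs_ballP[e /= e0 eA]; have L1 : 0 < L + 1 by rewrite ltr_wpDl.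
  apply/nbhs_ballP; exists (e / (L + 1)); first exact: divr_gt0.
  move=> y; rewrite -ball_normE /= => xy Om1y; apply: eA; rewrite -ball_normE /=.
  apply: le_lt_trans (ul _ _ Om1x Om1y) _.
  apply: (@le_lt_trans _ _ ((L + 1) * `|x - y|)); first by rewrite ler_wpM2r// lerDl.
  by rewrite mulrC -ltr_pdivlMr.
exists rho; split; last by rewrite /rho ux0 lnK.
split.
  split => // [x _|x Om1x]; first exact: expR_gt0.
  by have [m Om2m xm] := uv_eq _ Om1x; exists m; apply/mapE.
move=> E mE EOm2; rewrite /refractor_measure preimE.
have mpE := rel_preimage_measurable mOm1' uv_eq unique rel_closed mE.
rewrite nuhatE//; last by move=> x [].
exact: (rel_preimage_measure mOm1' mOm2 nu_ac uv_eq unique rel_closed mu_fin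
  mass mu_radon.2).
Qed.
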